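(* Let $a\in\mathbb Z_+=\{0,1,2,\dots\}$, $b\in\mathbb R$, and let $\alpha$ be a multi-index with $|\alpha|\le\lfloor d/2\rfloor+1$. Assume that either (i) $a=b=0$ and $\alpha\neq0$, or (ii) $\gamma a+b-|\alpha|>-d$. Then there exists a constant $N=N(d,a,b,\gamma,\nu)$ such that $$\sup_{s<t,\ x\in\mathbb R^d}|q_{\alpha,a,b}(s,t,x)|\le N .$$
   Context: Standing assumptions: $d\in\mathbb N$, $\gamma\in(0,\infty)$, $\nu>0$, and $\psi:\mathbb R\times\mathbb R^d\to\mathbb C$ is measurable with $\Re[\psi(t,\xi)]\le-\nu|\xi|^\gamma$ for all $(t,\xi)$ and $|D_\xi^\alpha\psi(t,\xi)|\le\nu^{-1}|\xi|^{\gamma-|\alpha|}$ for all $t\in\mathbb R$, $\xi\neq0$, $|\alpha|\le\lfloor d/2\rfloor+1$. For $s<t$, a multi-index $\alpha$, and $\xi\ne0$, $$\hat q_{\alpha,a,b}(s,t,\xi)=D_\xi^\alpha\Big[\big((t-s)\psi(t,(t-s)^{-1/\gamma}\xi)\big)^a|\xi|^b\exp\Big(\int_s^t\psi(r,(t-s)^{-1/\gamma}\xi)\,dr\Big)\Big],$$ and $q_{\alpha,a,b}(s,t,x)=\mathcal F^{-1}[\hat q_{\alpha,a,b}(s,t,\cdot)](x)$, where $\mathcal F^{-1}[g](x)=(2\pi)^{-d}\int_{\mathbb R^d}e^{i\xi\cdot x}g(\xi)\,d\xi$. (A zeroth power is $1$.) *)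

(* Defs.v *)
From HB Require Import structures.
From mathcomp Require Import all_boot all_order all_algebra.
From mathcomp Require Import all_classical all_reals all_analysis.
From mathcomp Require Import complex.

Set Implicit Arguments.
Unset Strict Implicit.
Unset Printing Implicit Defensive.
Import Order.TTheory GRing.Theory Num.Theory.
Import numFieldNormedType.Exports.
Import ComplexField.Normc.

Local Open Scope classical_set_scope.
Local Open Scope ring_scope.
Local Open Scope complex_scope.

(* The unqualified names denote [Num.Re] and [Num.Im], with values in [R[i]]. *)
Local Notation Re := (@complex.Re _).
Local Notation Im := (@complex.Im _).

(* [measurableTypeR R] is [R] with the display carried by [lebesgue_measure]. *)
Definition Rn (R : realType) (n : nat) := n.-tuple (measurableTypeR R).
HB.instance Definition _ R n := Measurable.on (Rn R n).

Section tuple_lebesgue.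
Context {R : realType}.

Definition tcons n (p : measurableTypeR R * Rn R n) : Rn R n.+1 :=
  [tuple of p.1 :: p.2].

Lemma measurable_tcons n : measurable_fun setT (@tcons n).
Proof. exact: measurable_cons. Qed.

Section step.
Variables (n : nat) (mu : {sigma_finite_measure set (Rn R n) -> \bar R}).

Definition lebesgue_step : set (Rn R n.+1) -> \bar R :=
  pushforward (lebesgue_measure \x mu)%E (@tcons n).

Let measurable_preimage A : measurable A -> measurable (@tcons n @^-1` A).
Proof. by move=> mA; rewrite -[X in measurable X]setTI; exact: measurable_tcons. Qed.

Let step0 : lebesgue_step set0 = 0%E.
Proof. by rewrite /lebesgue_step /pushforward preimage_set0 measure0. Qed.

Let step_ge0 A : (0 <= lebesgue_step A)%E.
Proof. by rewrite /lebesgue_step /pushforward. Qed.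

Let step_sigma_additive : semi_sigma_additive lebesgue_step.
Proof.
move=> F mF tF mUF; rewrite /lebesgue_step /pushforward preimage_bigcup.
apply: measure_semi_sigma_additive.
- by move=> k; exact: measurable_preimage.
- apply/trivIsetP => /= i j _ _ ij; rewrite -preimage_setI.
  by move/trivIsetP : tF => /(_ _ _ _ _ ij) ->//; rewrite preimage_set0.
- by rewrite -preimage_bigcup; exact: measurable_preimage.
Qed.

HB.instance Definition _ := isMeasure.Build _ _ _
  lebesgue_step step0 step_ge0 step_sigma_additive.

Let step_sigma_finite : sigma_finite setT lebesgue_step.
Proof.
have /sigma_finiteP[F [TF ndF Foo]] :=
  sigma_finiteT (@lebesgue_measure R : {sigma_finite_measure set _ -> \bar R}).
have /sigma_finiteP[G [TG ndG Goo]] := sigma_finiteT mu.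
pose un (t : Rn R n.+1) : measurableTypeR R * Rn R n :=
  (thead t, [tuple of behead t]).
have mun : measurable_fun setT un.
  apply/measurable_fun_pairP; split; first exact: measurable_tnth.
  exact: measurable_behead.
have unK : cancel un (@tcons n).
  by move=> t; rewrite /un /tcons /=; apply/val_inj; rewrite /= [in RHS](tuple_eta t).
have consK : cancel (@tcons n) un.
  by move=> [x t]; rewrite /un /tcons /= theadE; congr pair; apply/val_inj.
exists (fun k => un @^-1` (F k `*` G k)).
  apply/seteqP; split=> // t _.
  have : [set: measurableTypeR R] (un t).1 by [].
  have : [set: Rn R n] (un t).2 by [].
  rewrite TF TG => -[k _ Gk] [j _ Fj]; exists (maxn j k) => //; split.
    by move: Fj; exact/subsetPset/ndF/leq_maxl.
  by move: Gk; exact/subsetPset/ndG/leq_maxr.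
move=> k; have [mF Fk] := Foo k; have [mG Gk] := Goo k; split.
  by rewrite -[X in measurable X]setTI; apply: mun => //; exact: measurableX.
rewrite /lebesgue_step /pushforward -comp_preimage.
rewrite (_ : un \o _ = id) ?preimage_id; last by apply/funext => p; exact: consK.
by rewrite product_measure1E// lte_mul_pinfty// ge0_fin_numE.
Qed.

HB.instance Definition _ := Measure_isSigmaFinite.Build _ _ _
  lebesgue_step step_sigma_finite.

End step.

Fixpoint lebesgue_Rn n : {sigma_finite_measure set (Rn R n) -> \bar R} :=
  match n with
  | 0 => dirac [tuple]
  | n'.+1 => lebesgue_step (lebesgue_Rn n')
  end.

Lemma lebesgue_Rn_box n (A : 'I_n -> set (measurableTypeR R)) :
  (forall i, measurable (A i)) ->
  lebesgue_Rn n [set t | forall i, A i (tnth t i)] =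
    (\prod_(i < n) lebesgue_measure (A i))%E.
Proof.
elim: n A => [|n IH] A mA.
  rewrite big_ord0 /= diracE; apply/eqP; rewrite eqe pnatr_eq1 eqb1.
  by apply/mem_set => -[].
rewrite big_ord_recl -(IH (fun i => A (lift ord0 i)))//=.
rewrite /lebesgue_step /pushforward.
set B := [set t : Rn R n | forall i, A (lift ord0 i) (tnth t i)].
have mB : measurable B.
  have -> : B = \bigcap_(i in [set: 'I_n]) [set t | A (lift ord0 i) (tnth t i)].
    by apply/seteqP; split=> t /= h i; [move=> _; exact: h|exact: h].
  apply: fin_bigcap_measurable => // i _.
  rewrite -[X in measurable X]setTI.
  exact: (@measurable_tnth _ (measurableTypeR R) n i measurableT _ (mA (lift ord0 i))).
rewrite (_ : _ @^-1` _ = A ord0 `*` B) ?product_measure1E//.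
apply/seteqP; split=> -[x t] /=.
  by move=> h; split; [exact: (h ord0)|move=> i; have := h (lift ord0 i); rewrite tnthS].
by move=> [h0 h] i; case: (unliftP ord0 i) => [j|] ->; [rewrite tnthS; exact: h|].
Qed.

End tuple_lebesgue.

Section complex_valued.
Context {R : realType}.

Definition cexp (z : R[i]) : R[i] :=
  (expR (Re z) * cos (Im z)) +i* (expR (Re z) * sin (Im z)).

Section integral.
Context d (T : measurableType d).
Variable mu : {measure set T -> \bar R}.

Definition cmeasurable (f : T -> R[i]) :=
  measurable_fun setT (fun x => Re (f x)) /\
  measurable_fun setT (fun x => Im (f x)).

Definition cintegrable (D : set T) (f : T -> R[i]) :=
  mu.-integrable D (fun x => (Re (f x))%:E) /\
  mu.-integrable D (fun x => (Im (f x))%:E).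

(* [Rintegral] is total: it returns [fine] of the extended-real integral, so   *)
(* it is meaningful only together with [cintegrable].                         *)
Definition cintegral (D : set T) (f : T -> R[i]) : R[i] :=
  (\int[mu]_(x in D) Re (f x)) +i* (\int[mu]_(x in D) Im (f x)).

End integral.

Section partial_derivatives.
Variable n : nat.
Implicit Types (f : 'rV[R]_n -> R[i]) (U : set 'rV[R]_n).

Local Notation "''e_' i" := (delta_mx ord0 i) (at level 8, i at level 2).

Definition cderivable f x i :=
  derivable (fun y => Re (f y)) x ('e_i : 'rV[R]_n) /\
  derivable (fun y => Im (f y)) x ('e_i : 'rV[R]_n).

Definition cpartial i f : 'rV[R]_n -> R[i] := fun x =>
  ('D_('e_i : 'rV[R]_n) (fun y => Re (f y)) x) +i*
  ('D_('e_i : 'rV[R]_n) (fun y => Im (f y)) x).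

Definition mlen (alpha : 'I_n -> nat) : nat := (\sum_i alpha i)%N.

(* The variables of differentiation of [D^alpha], in the order                *)
(* D^alpha = D_0^(alpha 0) (D_1^(alpha 1) (...)); this order has to be fixed  *)
(* because only the existence of the derivatives is assumed below, not their  *)
(* continuity, so mixed derivatives of top order need not commute.            *)
Definition mseq (alpha : 'I_n -> nat) : seq 'I_n :=
  flatten [seq nseq (alpha i) i | i <- enum 'I_n].

Definition mderive (alpha : 'I_n -> nat) f : 'rV[R]_n -> R[i] :=
  foldr cpartial f (mseq alpha).

Fixpoint seq_derivable U (s : seq 'I_n) f : Prop :=
  if s is i :: s' then
    seq_derivable U s' f /\
    (forall x, U x -> cderivable (foldr cpartial f s') x i)
  else True.

(* [D^alpha f] exists at every point of [U]. *)
Definition mderivable U alpha f := seq_derivable U (mseq alpha) f.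

End partial_derivatives.

Section euclidean.
Variable n : nat.

Definition row_of (x : Rn R n) : 'rV[R]_n := \row_i tnth x i.

Definition dotp (x y : 'rV[R]_n) : R := \sum_i x ord0 i * y ord0 i.

(* The norm [`|x|] of the library on row vectors is the sup norm. *)
Definition enorm (x : 'rV[R]_n) : R := Num.sqrt (dotp x x).

Definition inv_fourier (g : 'rV[R]_n -> R[i]) (x : 'rV[R]_n) : R[i] :=
  (((2 * pi) ^+ n)^-1)%:C *
  cintegral (lebesgue_Rn n) setT
    (fun xi => cexp (0 +i* dotp (row_of xi) x) * g (row_of xi)).

End euclidean.

Section symbol.
Variable d : nat.
Implicit Types (gamma nu : R) (psi : R -> 'rV[R]_d -> R[i]).

Record symbol_assumption gamma nu psi : Prop := SymbolAssumption {
  symbol_measurable :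
    cmeasurable (fun p : measurableTypeR R * Rn R d => psi p.1 (row_of p.2)) ;
  symbol_elliptic : forall t xi,
    Re (psi t xi) <= - nu * enorm xi `^ gamma ;
  symbol_derivable : forall t (alpha : 'I_d -> nat),
    (mlen alpha <= (d %/ 2).+1)%N ->
    mderivable [set xi | xi != 0] alpha (psi t) ;
  symbol_regular : forall t xi (alpha : 'I_d -> nat),
    xi != 0 -> (mlen alpha <= (d %/ 2).+1)%N ->
    normc (mderive alpha (psi t) xi) <=
      nu^-1 * enorm xi `^ (gamma - (mlen alpha)%:R)
}.

Definition rescale gamma (s t : R) (xi : 'rV[R]_d) : 'rV[R]_d :=
  ((t - s) `^ (- gamma^-1)) *: xi.

Definition qhat0 gamma psi (a : nat) (b s t : R) (xi : 'rV[R]_d) : R[i] :=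
  ((t - s)%:C * psi t (rescale gamma s t xi)) ^+ a
  * (enorm xi `^ b)%:C
  * cexp (cintegral lebesgue_measure `[s, t]
            (fun r => psi r (rescale gamma s t xi))).

(* Only the values at [xi != 0] are meaningful; the origin is a null set. *)
Definition qhat gamma psi alpha a b s t : 'rV[R]_d -> R[i] :=
  mderive alpha (qhat0 gamma psi a b s t).

Definition q gamma psi alpha a b s t (x : 'rV[R]_d) : R[i] :=
  inv_fourier (qhat gamma psi alpha a b s t) x.

End symbol.
End complex_valued.

(* Main.v *)
(** Write Phi(xi) for the time integral of the rescaled symbol.  Rescaling gives
    |D^beta Phi| <= C |xi|^(gamma - |beta|) and Re Phi <= - nu |xi|^gamma, so by
    Leibniz' rule D^alpha of the product is at most
    K |xi|^p (1 + c |xi|^gamma)^k exp(- nu |xi|^gamma) away from the origin, with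
    p = gamma a + b - |alpha|.  When a = b = 0 and alpha <> 0, the innermost
    derivative of exp Phi produces a factor D_i Phi, and p improves to
    gamma - |alpha|, which is > - d because |alpha| <= floor(d/2) + 1 <= d.  As p > - d,
    this majorant is integrable, and its integral bounds the inverse Fourier
    transform uniformly.  The mixed derivatives need not commute, so all the
    estimates follow a fixed order of differentiation. *)

Require Import Defs.
From mathcomp Require Import all_boot all_order all_algebra.
From mathcomp Require Import all_classical all_reals all_analysis.
From mathcomp Require Import complex measurable_realfun.
From mathcomp Require Import ring lra.

Set Implicit Arguments.
Unset Strict Implicit.
Unset Printing Implicit Defensive.
Import Order.TTheory GRing.Theory Num.Theory.
Import numFieldNormedType.Exports.
Import ComplexField.Normc.

Local Open Scope classical_set_scope.
Local Open Scope ring_scope.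
Local Open Scope complex_scope.

Local Notation Re := (@complex.Re _).
Local Notation Im := (@complex.Im _).
Local Notation "''e_' i" := (delta_mx ord0 i) (at level 8, i at level 2).
Local Arguments normc : simpl never.

Section complex_modulus.
Context {R : realType}.
Implicit Types z w : R[i].

Lemma normc_ge0 z : 0 <= normc z.
Proof. by case: z => a b; rewrite /normc sqrtr_ge0. Qed.

Lemma normr_Re_le z : `|Re z| <= normc z.
Proof.
case: z => a b /=; rewrite /normc -sqrtr_sqr ler_wsqrtr// lerDl sqr_ge0//.
Qed.

Lemma normr_Im_le z : `|Im z| <= normc z.
Proof.
case: z => a b /=; rewrite /normc -sqrtr_sqr ler_wsqrtr// lerDr sqr_ge0//.
Qed.

Lemma normc_real (x : R) : normc x%:C = `|x|.
Proof. by rewrite /normc /= expr0n/= addr0 sqrtr_sqr. Qed.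

Lemma normc_imag (x : R) : normc (0 +i* x) = `|x|.
Proof. by rewrite /normc /= expr0n/= add0r sqrtr_sqr. Qed.

Lemma normc_le_ReIm z : normc z <= `|Re z| + `|Im z|.
Proof.
have -> : z = (Re z)%:C + (0 +i* Im z).
  by case: z => a b; rewrite /= /GRing.add /= addr0 add0r.
by rewrite (le_trans (le_normcD _ _))// normc_real normc_imag /= addr0 add0r.
Qed.

Lemma normc_cexp z : normc (cexp z) = expR (Re z).
Proof.
rewrite /cexp /normc !exprMn -mulrDr cos2Dsin2 mulr1 sqrtr_sqr.
by rewrite ger0_norm// expR_ge0.
Qed.

Lemma ReM z w : Re (z * w) = Re z * Re w - Im z * Im w.
Proof. by case: z => a b; case: w => c d. Qed.

Lemma ImM z w : Im (z * w) = Re z * Im w + Im z * Re w.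
Proof. by case: z => a b; case: w => c d. Qed.

Lemma ReD z w : Re (z + w) = Re z + Re w.
Proof. by case: z => a b; case: w => c d. Qed.

Lemma ImD z w : Im (z + w) = Im z + Im w.
Proof. by case: z => a b; case: w => c d. Qed.

Lemma complex_eq z w : Re z = Re w -> Im z = Im w -> z = w.
Proof. by case: z => a b; case: w => c d /= -> ->. Qed.

End complex_modulus.

Section partial_derivatives.
Context {R : realType} {n : nat}.
Implicit Types (f h : 'rV[R]_n -> R[i]) (x : 'rV[R]_n) (i : 'I_n).

Definition is_cpartial f x i (D : R[i]) :=
  is_derive x ('e_i : 'rV[R]_n) (fun y => Re (f y)) (Re D) /\
  is_derive x ('e_i : 'rV[R]_n) (fun y => Im (f y)) (Im D).

Lemma is_cpartialP f x i D :
  is_cpartial f x i D <-> cderivable f x i /\ cpartial i f x = D.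
Proof.
split=> [[[d1 e1] [d2 e2]]|[[d1 d2] <-]].
  by split=> //; apply: complex_eq.
by split; exact: derivableP.
Qed.

Lemma cderivableP f x i : cderivable f x i -> is_cpartial f x i (cpartial i f x).
Proof. by move=> fx; apply/is_cpartialP. Qed.

Lemma near_is_cpartial f h x i D : {near x, f =1 h} ->
  is_cpartial f x i D -> is_cpartial h x i D.
Proof.
move=> fh [d1 d2]; split.
- apply: near_eq_is_derive d1; apply: filterS fh => y /= -> //.
- apply: near_eq_is_derive d2; apply: filterS fh => y /= -> //.
Qed.

Lemma is_cpartial_cst c x i : is_cpartial (cst c) x i 0.
Proof. by split; apply: is_derive_cst. Qed.

Lemma is_cpartialD f h x i D E : is_cpartial f x i D -> is_cpartial h x i E ->
  is_cpartial (fun y => f y + h y) x i (D + E).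
Proof.
move=> [d1 d2] [e1 e2]; split.
- rewrite (_ : (fun _ => _) = (fun y => Re (f y)) + (fun y => Re (h y))).
    by rewrite ReD; apply: is_deriveD.
  by apply/funext => y; rewrite ReD.
- rewrite (_ : (fun _ => _) = (fun y => Im (f y)) + (fun y => Im (h y))).
    by rewrite ImD; apply: is_deriveD.
  by apply/funext => y; rewrite ImD.
Qed.

Lemma is_cpartialM f h x i D E : is_cpartial f x i D -> is_cpartial h x i E ->
  is_cpartial (fun y => f y * h y) x i (D * h x + f x * E).
Proof.
move=> [d1 d2] [e1 e2]; split.
- rewrite (_ : (fun _ => _) = (fun y => Re (f y)) * (fun y => Re (h y))
     - (fun y => Im (f y)) * (fun y => Im (h y))); last first.
    by apply/funext => y; rewrite ReM.
  apply: (is_derive_eq (is_deriveB (is_deriveM d1 e1) (is_deriveM d2 e2))).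
  by rewrite ReD !ReM /GRing.scale /=; ring.
- rewrite (_ : (fun _ => _) = (fun y => Re (f y)) * (fun y => Im (h y))
     + (fun y => Im (f y)) * (fun y => Re (h y))); last first.
    by apply/funext => y; rewrite ImM.
  apply: (is_derive_eq (is_deriveD (is_deriveM d1 e2) (is_deriveM d2 e1))).
  by rewrite ImD !ImM /GRing.scale /=; ring.
Qed.

Lemma is_derive_line (f : 'rV[R]_n -> R) x v (df : R) :
  is_derive x v f df <-> is_derive (0 : R) 1 (fun t : R => f (t *: v + x)) df.
Proof.
have e : 'D_v f x = 'D_1 (fun t : R => f (t *: v + x)) 0.
  rewrite /derive; set g1 := fun t => _ *: _; set g2 := fun t => _ *: _.
  suff -> : g1 = g2 by [].
  by apply/funext => t; rewrite /g1 /g2 /= addr0 scale0r add0r [_%:A]mulr1.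
split=> -[d1 d2].
  by apply: DeriveDef; [move/derivable1P : d1|rewrite -e].
by apply: DeriveDef; [apply/derivable1P|rewrite e].
Qed.

Lemma is_derive_comp (F : R -> R) (f : 'rV[R]_n -> R) x v (a b : R) :
  is_derive (f x) 1 F a -> is_derive x v f b -> is_derive x v (F \o f) (a * b).
Proof.
move=> dF /is_derive_line df; apply/is_derive_line.
apply: (@is_derive1_comp _ F (fun t : R => f (t *: v + x))) => //.
by rewrite scale0r add0r.
Qed.

Lemma is_cpartial_cexp f x i D : is_cpartial f x i D ->
  is_cpartial (fun y => cexp (f y)) x i (D * cexp (f x)).
Proof.
move=> [d1 d2].
have dexp := is_derive_comp (is_derive_expR _) d1.
have dcos := is_derive_comp (is_derive_cos _) d2.
have dsin := is_derive_comp (is_derive_sin _) d2.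
split.
- apply: (is_derive_eq (is_deriveM dexp dcos)).
  by rewrite ReM /= /GRing.scale /=; ring.
- apply: (is_derive_eq (is_deriveM dexp dsin)).
  by rewrite ImM /= /GRing.scale /=; ring.
Qed.

Lemma is_cpartialZ (c : R) f x i D : is_cpartial f (c *: x) i D ->
  is_cpartial (fun y => f (c *: y)) x i (c%:C * D).
Proof.
have main (u : 'rV[R]_n -> R) (d : R) :
    is_derive (c *: x) ('e_i : 'rV[R]_n) u d ->
    is_derive x ('e_i : 'rV[R]_n) (fun y => u (c *: y)) (c * d).
  move=> /is_derive_line ud; apply/is_derive_line.
  rewrite (_ : (fun _ => _) = (fun t : R => u (t *: 'e_i + c *: x)) \o ( *%R c)).
    rewrite mulrC; apply: is_derive1_comp; first by rewrite mulr0.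
    rewrite (_ : *%R c = c *: id); last by apply/funext.
    by apply: is_derive_eq; rewrite /GRing.scale /= mulr1.
  by apply/funext => t /=; rewrite scalerDr scalerA.
move=> [d1 d2]; split.
- by rewrite [Re (_ * _)]ReM /= mul0r subr0; exact: (main (fun y => Re (f y))).
- by rewrite [Im (_ * _)]ImM /= mul0r addr0; exact: (main (fun y => Im (f y))).
Qed.

Lemma is_cpartial_real (u : 'rV[R]_n -> R) x i (d : R) :
  is_derive x ('e_i : 'rV[R]_n) u d -> is_cpartial (fun y => (u y)%:C) x i d%:C.
Proof. by move=> ud; split => //=; exact: is_derive_cst. Qed.

End partial_derivatives.

Section euclidean_norm.
Context {R : realType} {n : nat}.
Implicit Types x : 'rV[R]_n.

Lemma dotpxx_ge0 x : 0 <= dotp x x.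
Proof. by apply: sumr_ge0 => i _; rewrite -expr2 sqr_ge0. Qed.

Lemma enorm_ge0 x : 0 <= enorm x.
Proof. exact: sqrtr_ge0. Qed.

Lemma dotpxx_gt0 x : x != 0 -> 0 < dotp x x.
Proof.
move=> x0; rewrite lt_neqAle dotpxx_ge0 andbT eq_sym psumr_eq0; last first.
  by move=> i _; rewrite -expr2 sqr_ge0.
apply: contra x0 => /allP xi0; apply/eqP/rowP => i; rewrite mxE.
by have := xi0 i (mem_index_enum _); rewrite /= -expr2 sqrf_eq0 => /eqP.
Qed.

Lemma enorm_gt0 x : x != 0 -> 0 < enorm x.
Proof. by move=> x0; rewrite sqrtr_gt0 dotpxx_gt0. Qed.

Lemma enormZ (c : R) x : 0 <= c -> enorm (c *: x) = c * enorm x.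
Proof.
move=> c0; rewrite /enorm.
have -> : dotp (c *: x) (c *: x) = c ^+ 2 * dotp x x.
  by rewrite mulr_sumr; apply: eq_bigr => i _; rewrite !mxE; ring.
by rewrite sqrtrM ?sqr_ge0// sqrtr_sqr ger0_norm.
Qed.

Lemma coord_le_enorm x i : `|x ord0 i| <= enorm x.
Proof.
rewrite -sqrtr_sqr ler_wsqrtr// /dotp (bigD1 i)//= -expr2 lerDl.
by apply: sumr_ge0 => j _; rewrite -expr2 sqr_ge0.
Qed.

Lemma enorm_powR x b : enorm x `^ b = dotp x x `^ (b / 2).
Proof. by rewrite /enorm -powR12_sqrt ?dotpxx_ge0// -powRrM mulrC. Qed.

Lemma dotp_line x i (t : R) : dotp (t *: 'e_i + x) (t *: 'e_i + x) =
  dotp x x + 2 * x ord0 i * t + t ^+ 2.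
Proof.
rewrite /dotp (bigD1 i)//= [in RHS](bigD1 i)//= !mxE !eqxx /=.
under eq_bigr => j ji.
  rewrite !mxE eqxx /= (negbTE ji) mulr0 add0r. over.
by ring.
Qed.

Lemma is_derive_dotp x i :
  is_derive x ('e_i : 'rV[R]_n) (fun y => dotp y y) (2 * x ord0 i).
Proof.
apply/is_derive_line; under eq_fun do rewrite dotp_line.
rewrite (_ : (fun _ => _) =
  cst (dotp x x) + (2 * x ord0 i) *: (id : R -> R) + id * id); last first.
  by apply/funext => t; rewrite expr2.
apply: (is_derive_eq (is_deriveD (is_deriveD (is_derive_cst _ _ _)
  (is_deriveZ _ (is_derive_id _ _))) (is_deriveM (is_derive_id _ _) (is_derive_id _ _)))).
by rewrite /GRing.scale/=; ring.
Qed.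

Lemma is_derive_enorm_powR x i b : x != 0 ->
  is_derive x ('e_i : 'rV[R]_n) (fun y => enorm y `^ b)
    (b * x ord0 i * enorm x `^ (b - 2)).
Proof.
move=> x0; under eq_fun do rewrite enorm_powR.
apply: is_derive_eq.
  apply: (@is_derive_comp _ _ (fun r => r `^ (b / 2)) (fun y => dotp y y)).
    by apply: is_derive1_powR; exact: dotpxx_gt0.
  exact: is_derive_dotp.
rewrite enorm_powR (_ : (b - 2) / 2 = b / 2 - 1); last by field.
by field.
Qed.

Lemma is_derive_coord x i j :
  is_derive x ('e_i : 'rV[R]_n) (fun y : 'rV[R]_n => y ord0 j) ((i == j)%:R : R).
Proof.
apply/is_derive_line.
rewrite (_ : (fun _ => _) = (i == j)%:R *: id + cst (x ord0 j)).
  by apply: is_derive_eq; rewrite /GRing.scale /= mulr1 addr0.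
by apply/funext => t; rewrite !mxE eqxx /= eq_sym mulrC.
Qed.

Lemma near_neq0 x : x != 0 -> \forall y \near x, y != 0.
Proof.
move=> x0.
by apply: (@cvgr_neq0 _ _ _ (nbhs x) _ id x _ x0) => //; exact: cvg_id.
Qed.

End euclidean_norm.

Section symbol_classes.
Context {R : realType} {n : nat}.
Implicit Types (f h : 'rV[R]_n -> R[i]) (g : 'rV[R]_n -> R) (x : 'rV[R]_n)
  (l : seq 'I_n).

(* [symb l g f]: away from the origin, the derivatives of [f] along every
   subsequence of [l] exist and are bounded by [g / |x|^k], [k] being the order of
   the derivative. The head of [l] is differentiated first, so that the order
   [foldr cpartial f s] of [mderive] corresponds to [l = rev s]. *)
Fixpoint symb l g f : Prop :=
  if l is i :: l' then
    [/\ symb l' g f,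
        forall x, x != 0 -> cderivable f x i &
        symb l' (fun x => g x * (enorm x)^-1) (cpartial i f)]
  else forall x, x != 0 -> normc (f x) <= g x.

Lemma symb_bound l g f : symb l g f -> forall x, x != 0 -> normc (f x) <= g x.
Proof. by elim: l => //= i l IH [] /IH. Qed.

Lemma eq_cpartial f h i : (forall x, x != 0 -> f x = h x) ->
  forall x, x != 0 -> cderivable f x i -> is_cpartial h x i (cpartial i f x).
Proof.
move=> fh x x0 /cderivableP; apply: near_is_cpartial.
by apply: filterS (near_neq0 x0) => y /fh.
Qed.

Lemma eq_symb l g f h : (forall x, x != 0 -> f x = h x) -> symb l g f -> symb l g h.
Proof.
elim: l g f h => [|i l IH] g f h fh /=; first by move=> fg x x0; rewrite -fh// fg.
move=> [fg df dfg]; split; first exact: IH fg.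
  by move=> x x0; have /is_cpartialP[] := eq_cpartial fh x0 (df x x0).
by apply: IH dfg => x x0; have /is_cpartialP[_ ->] := eq_cpartial fh x0 (df x x0).
Qed.

Lemma symb_cons i l g f (D : 'rV[R]_n -> R[i]) : symb l g f ->
  (forall x, x != 0 -> is_cpartial f x i (D x)) ->
  symb l (fun x => g x * (enorm x)^-1) D -> symb (i :: l) g f.
Proof.
move=> fg fD Dg; split => //; first by move=> x /fD /is_cpartialP[].
by apply: eq_symb Dg => x /fD /is_cpartialP[_ ->].
Qed.

Lemma le_symb l g1 g2 f : (forall x, x != 0 -> g1 x <= g2 x) ->
  symb l g1 f -> symb l g2 f.
Proof.
elim: l g1 g2 f => [|i l IH] g1 g2 f g12 /=.
  by move=> fg x x0; exact: le_trans (fg x x0) (g12 x x0).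
move=> [fg df dfg]; split => //; first exact: IH g12 fg.
apply: IH dfg => x x0; rewrite ler_wpM2r ?invr_ge0 ?enorm_ge0 ?g12//.
Qed.

Lemma symbD l g1 g2 f1 f2 : symb l g1 f1 -> symb l g2 f2 ->
  symb l (fun x => g1 x + g2 x) (fun x => f1 x + f2 x).
Proof.
elim: l g1 g2 f1 f2 => [|i l IH] g1 g2 f1 f2 /=.
  by move=> fg1 fg2 x x0; rewrite (le_trans (le_normcD _ _))// lerD ?fg1 ?fg2.
move=> [fg1 d1 dg1] [fg2 d2 dg2].
apply: (@symb_cons _ _ _ _ (fun x => cpartial i f1 x + cpartial i f2 x)).
- exact: IH.
- by move=> x x0; apply: is_cpartialD; apply: cderivableP; auto.
- by apply: le_symb (IH _ _ _ _ dg1 dg2) => x x0; rewrite mulrDl.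
Qed.

(* Leibniz' rule; each differentiation doubles the number of terms. *)
Lemma symbM l g1 g2 f1 f2 : symb l g1 f1 -> symb l g2 f2 ->
  symb l (fun x => 2 ^+ size l * (g1 x * g2 x)) (fun x => f1 x * f2 x).
Proof.
elim: l g1 g2 f1 f2 => [|i l IH] g1 g2 f1 f2.
  move=> /= fg1 fg2 x x0.
  by rewrite expr0 mul1r normcM ler_pM ?normc_ge0 ?fg1 ?fg2.
move=> [fg1 d1 dg1] [fg2 d2 dg2].
have g1_ge0 x : x != 0 -> 0 <= g1 x.
  by move=> x0; exact: le_trans (normc_ge0 _) (symb_bound fg1 x0).
have g2_ge0 x : x != 0 -> 0 <= g2 x.
  by move=> x0; exact: le_trans (normc_ge0 _) (symb_bound fg2 x0).
apply: (@symb_cons _ _ _ _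
    (fun x => cpartial i f1 x * f2 x + f1 x * cpartial i f2 x)).
- apply: le_symb (IH _ _ _ _ fg1 fg2) => x x0.
  by rewrite ler_wpM2r ?mulr_ge0 ?g1_ge0 ?g2_ge0// /= exprS ler_peMl// ler1n.
- by move=> x x0; apply: is_cpartialM; apply: cderivableP; auto.
- apply: le_symb (symbD (IH _ _ _ _ dg1 fg2) (IH _ _ _ _ fg1 dg2)) => x x0.
  by rewrite /= exprS le_eqVlt; apply/orP; left; apply/eqP; ring.
Qed.

Lemma symb_cst l (c : R[i]) : symb l (fun=> normc c) (cst c).
Proof.
suff H (M : 'rV[R]_n -> R) (d : R[i]) : (forall x, x != 0 -> normc d <= M x) ->
    symb l M (cst d) by apply: H => x _.
elim: l M d => [|i l IH] M d dM //=.
apply: (@symb_cons _ _ _ _ (cst 0)).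
- exact: IH.
- by move=> x x0; exact: is_cpartial_cst.
- apply: IH => x x0; rewrite normc0 mulr_ge0 ?invr_ge0 ?enorm_ge0//.
  exact: le_trans (normc_ge0 _) (dM x x0).
Qed.

Lemma symbX l g f k : symb l g f ->
  symb l (fun x => 2 ^+ (size l * k) * g x ^+ k) (fun x => f x ^+ k).
Proof.
move=> fg; elim: k => [|k IH].
  by apply: le_symb (symb_cst l 1) => x x0; rewrite normc1 muln0 !expr0 mul1r.
have -> : (fun x => f x ^+ k.+1) = (fun x => f x * f x ^+ k).
  by apply/funext => x; rewrite exprS.
apply: le_symb (symbM fg IH) => x x0.
by rewrite mulnS exprD exprS le_eqVlt; apply/orP; left; apply/eqP; ring.
Qed.

Lemma symb_rescale l g f (c : R) : 0 < c -> symb l g f ->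
  symb l (fun x => g (c *: x)) (fun x => f (c *: x)).
Proof.
move=> c0; elim: l g f => [|i l IH] g f /=.
  by move=> fg x x0; rewrite fg// scaler_eq0 negb_or gt_eqF.
move=> [fg df dfg].
apply: (@symb_cons _ _ _ _ (fun x => c%:C * cpartial i f (c *: x))).
- exact: IH.
- move=> x x0; apply/is_cpartialZ/cderivableP/df.
  by rewrite scaler_eq0 negb_or gt_eqF.
- have H (M : 'rV[R]_n -> R) (d : 'rV[R]_n -> R[i]) : symb l M d ->
      symb l (fun x => c * M x) (fun x => c%:C * d x).
    elim: l {IH fg dfg} M d => [|j l IH] M d /=.
      by move=> dM x x0; rewrite normcM normc_real gtr0_norm// (ler_wpM2l (ltW c0))// dM.
    move=> [dM dd ddM].
    apply: (@symb_cons _ _ _ _ (fun x => c%:C * cpartial j d x)).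
    + exact: IH.
    + move=> x x0.
      have := is_cpartialM (is_cpartial_cst c%:C x j) (cderivableP (dd x x0)).
      by rewrite mul0r add0r.
    + by apply: le_symb (IH _ _ ddM) => x x0; rewrite mulrA.
  apply: le_symb (H _ _ (IH _ _ dfg)) => x x0.
  by rewrite (enormZ _ (ltW c0)) invfM mulrCA (mulrA c) divff ?gt_eqF// mul1r.
Qed.

Lemma symb_enorm_powR (k : nat) (b : R) : exists2 C : R, 0 <= C &
  forall l, size l = k ->
    symb l (fun x => C * enorm x `^ b) (fun x => (enorm x `^ b)%:C).
Proof.
have coord l j : symb l (fun x => enorm x) (fun x => (x ord0 j)%:C).
  elim: l => [|i l IH] /=; first by move=> x _; rewrite normc_real coord_le_enorm.
  apply: (@symb_cons _ _ _ _ (cst ((i == j)%:R : R)%:C)) => //.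
    by move=> x x0; apply: is_cpartial_real; exact: is_derive_coord.
  apply: le_symb (symb_cst _ _) => x x0.
  rewrite normc_real divff; last by rewrite gt_eqF ?enorm_gt0.
  by case: (i == j); rewrite ?normr1// normr0.
elim: k b => [|k IH] b.
  exists 1 => // -[]//= _ x x0.
  by rewrite mul1r normc_real ger0_norm// powR_ge0.
have [C1 C1_ge0 H1] := IH b; have [C2 C2_ge0 H2] := IH (b - 2).
pose C := 2 ^+ k * (`|b| * (2 ^+ k * C2)).
have C_ge0 : 0 <= C by rewrite !mulr_ge0.
exists (C1 + C); rewrite ?addr_ge0// => -[//|i l] [sl].
apply: (@symb_cons _ _ _ _
  (fun x => b%:C * ((x ord0 i)%:C * (enorm x `^ (b - 2))%:C))).
- apply: le_symb (H1 l sl) => x x0.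
  by rewrite ler_wpM2r ?powR_ge0// lerDl.
- move=> x x0; rewrite -!rmorphM /= mulrA.
  by apply: is_cpartial_real; exact: is_derive_enorm_powR.
- apply: le_symb (symbM (symb_cst l b%:C) (symbM (coord l i) (H2 l sl))) => x x0.
  rewrite normc_real sl.
  have -> : enorm x `^ (b - 2) = enorm x `^ b / enorm x ^+ 2.
    rewrite powRB ?powR_mulrn ?enorm_ge0//.
    by apply/implyP => _; rewrite gt_eqF ?enorm_gt0.
  have e0 : enorm x != 0 by rewrite gt_eqF ?enorm_gt0.
  rewrite [leLHS](_ : _ = C * enorm x `^ b / enorm x); last first.
    by rewrite /C; field.
  rewrite ler_wpM2r ?invr_ge0 ?enorm_ge0// ler_wpM2r ?powR_ge0// lerDr//.
Qed.

Lemma symb_cexp_cons i l g g' f : symb (i :: l) g f ->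
  symb l g' (fun x => cexp (f x)) ->
  symb l (fun x => 2 ^+ size l * (g x * g' x) * (enorm x)^-1)
    (cpartial i (fun x => cexp (f x))).
Proof.
move=> [fg df dfg] eg.
apply: (@eq_symb _ _ (fun x => cpartial i f x * cexp (f x))).
  move=> x x0; apply/esym.
  by have /is_cpartialP[_ ->] := is_cpartial_cexp (cderivableP (df x x0)).
apply: le_symb (symbM dfg eg) => x x0.
by rewrite le_eqVlt; apply/orP; left; apply/eqP; ring.
Qed.

Lemma symb_cexp l g f (u : 'rV[R]_n -> R) : symb l g f ->
  (forall x, x != 0 -> Re (f x) <= u x) ->
  symb l (fun x => (1 + 2 ^+ size l * g x) ^+ size l * expR (u x))
    (fun x => cexp (f x)).
Proof.
move=> + fu; elim: l => [|i l IH] fg.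
  by move=> x x0; rewrite /= expr0 mul1r normc_cexp ler_expR fu.
have [/IH eg df _] := fg.
have g_ge0 x : x != 0 -> 0 <= g x.
  by move=> x0; exact: le_trans (normc_ge0 _) (symb_bound fg x0).
have step x : x != 0 -> 0 <= 2 ^+ size l * g x <= 2 ^+ (size l).+1 * g x.
  move=> x0; rewrite mulr_ge0 ?g_ge0 //= ler_wpM2r ?g_ge0// exprS.
  by rewrite ler_peMl// ler1n.
pose B x := (1 + 2 ^+ (size l).+1 * g x) ^+ (size l) * expR (u x).
have B_ge0 x : x != 0 -> 0 <= B x.
  move=> /step /andP[s1 s2]; rewrite mulr_ge0 ?expR_ge0// exprn_ge0// addr_ge0//.
  exact: le_trans s2.
have {}eg : symb l B (fun x => cexp (f x)).
  apply: le_symb eg => x /step /andP[s1 s2].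
  rewrite ler_wpM2r ?expR_ge0// lerXn2r ?nnegrE ?addr_ge0//.
    exact: le_trans s2.
  by rewrite lerD2l.
have BE x : (1 + 2 ^+ (size l).+1 * g x) ^+ (size l).+1 * expR (u x) =
    B x + 2 ^+ (size l).+1 * g x * B x by rewrite /B exprS; ring.
split.
- apply: le_symb eg => x x0; rewrite BE lerDl mulr_ge0 ?B_ge0//.
  by have /andP[/le_trans h /h] := step x x0.
- by move=> x x0; have /is_cpartialP[] := is_cpartial_cexp (cderivableP (df x x0)).
- apply: le_symb (symb_cexp_cons fg eg) => x x0.
  rewrite ler_wpM2r ?invr_ge0 ?enorm_ge0// [size (i :: l)]/= BE.
  rewrite -[leLHS]add0r lerD ?B_ge0// mulrA ler_wpM2r ?B_ge0//.
  by have /andP[] := step x x0.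
Qed.

End symbol_classes.

Section multi_indices.
Context {R : realType} {n : nat}.
Implicit Types (f : 'rV[R]_n -> R[i]) (s : seq 'I_n) (alpha : 'I_n -> nat).
Local Notation U := [set x : 'rV[R]_n | x != 0].

Lemma seq_derivable_rcons s i f : seq_derivable U (rcons s i) f <->
  (forall x, x != 0 -> cderivable f x i) /\ seq_derivable U s (cpartial i f).
Proof.
elim: s => [|j s IH] /=; first by split=> -[].
rewrite foldr_rcons; split.
  by move=> [/IH[? ?] ?].
by move=> [? [? ?]]; split=> //; apply/IH.
Qed.

Lemma symb_foldr s g f : symb (rev s) g f -> seq_derivable U s f /\
  forall x, x != 0 -> normc (foldr (@cpartial R n) f s x) <= g x * (enorm x)^-1 ^+ size s.
Proof.
elim/last_ind: s g f => [|s i IH] g f.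
  by move=> /= fg; split => // x x0; rewrite expr0 mulr1 fg.
rewrite rev_rcons => -[fg df /IH[ds dsg]]; split.
  by apply/seq_derivable_rcons.
move=> x x0; rewrite foldr_rcons (le_trans (dsg _ x0))//.
by rewrite size_rcons exprS mulrA.
Qed.

Lemma foldr_symb s g f : (forall s', subseq s' s -> seq_derivable U s' f /\
    forall x, x != 0 ->
      normc (foldr (@cpartial R n) f s' x) <= g x * (enorm x)^-1 ^+ size s') ->
  symb (rev s) g f.
Proof.
elim/last_ind: s g f => [|s i IH] g f sf.
  by move=> x x0; have [_ /(_ x x0)] := sf [::] (sub0seq _); rewrite expr0 mulr1.
rewrite rev_rcons; split.
- apply: IH => s' s's; apply: sf; apply: subseq_trans s's _.
  exact: subseq_rcons.
- have [|+ _] := sf [:: i]; first by rewrite sub1seq mem_rcons mem_head.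
  by case.
- apply: IH => s' s's; have [|/seq_derivable_rcons[_ ds] dsg] := sf (rcons s' i).
    by rewrite -!cats1 cat_subseq.
  split=> // x x0; have := dsg x x0.
  by rewrite foldr_rcons size_rcons exprS mulrA.
Qed.

Lemma size_mseq alpha : size (mseq alpha) = mlen alpha.
Proof.
rewrite size_flatten /shape -map_comp sumnE big_map big_enum /=.
by apply: eq_bigr => i _; rewrite size_nseq.
Qed.

Lemma count_mem_mseq alpha i : count_mem i (mseq alpha) = alpha i.
Proof.
rewrite count_flatten -map_comp sumnE big_map big_enum /= (bigD1 i)//=.
rewrite count_nseq /= eqxx mul1n big1 ?addn0// => j ji.
by rewrite count_nseq /= (negbTE ji).
Qed.

Lemma sorted_mseq alpha : sorted (fun i j : 'I_n => i <= j)%N (mseq alpha).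
Proof.
pose r := (fun i j : 'I_n => i <= j)%N.
have r_tr : transitive r by move=> i j k; exact: leq_trans.
rewrite (sorted_pairwise r_tr) /mseq.
have : pairwise r (enum 'I_n).
  rewrite -(sorted_pairwise r_tr) -(@sorted_map _ _ val leq) val_enum_ord.
  exact: iota_sorted.
elim: (enum 'I_n) => //= i s IH /andP[/allP is_ /IH ps].
rewrite pairwise_cat ps andbT; apply/andP; split.
- apply/allrelP => j k /nseqP[-> _] /flattenP[t /mapP[m ms ->]] /nseqP[-> _].
  exact: is_.
- by elim: (alpha i) => //= k ->; rewrite andbT; apply/allP => j /nseqP[->]; rewrite /r.
Qed.

(* This is why derivatives along subsequences, as in Leibniz' rule, are again of the
   form [mderive beta f] even though partial derivatives need not commute. *)
Lemma subseq_mseq s alpha : subseq s (mseq alpha) ->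
  s = mseq (fun i => count_mem i s).
Proof.
move=> s_alpha.
apply: (@sorted_eq _ (fun i j : 'I_n => i <= j)%N) => [i j k|i j|||].
- exact: leq_trans.
- by move=> /anti_leq /val_inj.
- apply: subseq_sorted s_alpha (sorted_mseq _) => i j k; exact: leq_trans.
- exact: sorted_mseq.
- by apply/allP => i _; rewrite /= count_mem_mseq.
Qed.

Lemma mseq_symb g f alpha :
  (forall beta : 'I_n -> nat, (mlen beta <= mlen alpha)%N ->
    mderivable U beta f /\ forall x, x != 0 ->
      normc (mderive beta f x) <= g x * (enorm x)^-1 ^+ mlen beta) ->
  symb (rev (mseq alpha)) g f.
Proof.
move=> H; apply: foldr_symb => s s_alpha.
have [] := H (fun i => count_mem i s).
  rewrite -!size_mseq -(subseq_mseq s_alpha); exact: size_subseq.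
rewrite /mderivable /mderive -(subseq_mseq s_alpha) => ds sg; split=> // x x0.
by have := sg x x0; rewrite -size_mseq -(subseq_mseq s_alpha).
Qed.

End multi_indices.

Section derivatives_under_integral.
Context {R : realType}.
Local Notation mu := (@lebesgue_measure R).

Lemma measurable_derive_line d (T : measurableType d) (D : set T) (G : T -> R -> R)
    (e : R) : 0 < e -> measurable_fun D (G ^~ 0) ->
  (forall h, 0 < h < e -> measurable_fun D (G ^~ h)) ->
  (forall t, D t -> derivable (G t) 0 1) ->
  measurable_fun D (fun t => 'D_1 (G t) 0).
Proof.
move=> e0 mG0 mG dG.
pose h (k : nat) : R := e / k.+2%:R.
have h_lt k : 0 < h k < e.
  by rewrite divr_gt0//= ltr_pdivrMr// ltr_pMr// ltr1n.
have h_cvg : h k @[k --> \oo] --> (0 : R).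
  rewrite -(mulr0 e); apply: cvgMl_tmp.
  have := @cvg_harmonic R; rewrite -(cvg_shiftS (@harmonic R)); exact.
apply: (@measurable_fun_cvg _ _ _ _
  (fun k t => (h k)^-1 * (G t (h k) - G t 0))) => [k|t Dt].
  by apply: measurable_funM => //; apply: measurable_funB => //; apply: mG.
have : (fun u : R => u^-1 *: ((G t \o shift 0) (u *: 1) - G t 0)) u @[u --> 0^'] -->
    'D_1 (G t) 0 by exact: dG.
move/cvgr_dnbhsP => /(_ h) cvgG.
under eq_fun do rewrite -[X in G _ X]addr0 -[X in G _ (X + _)]mulr1.
by apply: cvgG; split => // k; rewrite gt_eqF//; have /andP[] := h_lt k.
Qed.

Lemma is_derive_line_shift n (f : 'rV[R]_n -> R) x v (t df : R) :
  is_derive (t *: v + x) v f df ->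
  is_derive t 1 (fun r : R => f (r *: v + x)) df.
Proof.
move/is_derive_line => dff.
rewrite (_ : (fun _ => _) = (fun r : R => f (r *: v + (t *: v + x))) \o (fun r => r - t)).
  rewrite -[df]mulr1; apply: is_derive1_comp; rewrite ?subrr//.
  by apply: is_derive_eq; rewrite subr0.
by apply/funext => r /=; rewrite addrA -scalerDl subrK.
Qed.

Lemma powR_between (a b y q : R) : 0 < a -> a <= y <= b ->
  y `^ q <= a `^ q + b `^ q.
Proof.
move=> a0 /andP[ay yb]; have y0 := lt_le_trans a0 ay.
have [q0|q0] := leP 0 q.
  rewrite (@le_trans _ _ (b `^ q))// ?lerDr ?powR_ge0//.
  by rewrite ge0_ler_powR// nnegrE ?(ltW y0)// (le_trans (ltW y0)).
rewrite (@le_trans _ _ (a `^ q))// ?lerDl ?powR_ge0//.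
rewrite -(opprK q) !(powRN _ (- q)) lef_pV2 ?posrE ?powR_gt0//.
by rewrite ge0_ler_powR ?nnegrE ?(ltW y0) ?(ltW a0)// oppr_ge0 ltW.
Qed.

Lemma enorm_line n (x : 'rV[R]_n) i (h : R) : `|h| <= enorm x ->
  enorm x - `|h| <= enorm (h *: 'e_i + x) <= enorm x + `|h|.
Proof.
move=> hx.
have sq : enorm (h *: 'e_i + x) ^+ 2 = enorm x ^+ 2 + 2 * x ord0 i * h + h ^+ 2.
  by rewrite !sqr_sqrtr ?dotpxx_ge0// dotp_line.
have xh : `|x ord0 i * h| <= enorm x * `|h|.
  by rewrite normrM ler_wpM2r// coord_le_enorm.
have h2 : `|h| ^+ 2 = h ^+ 2 by rewrite real_normK// num_real.
have := enorm_ge0 x; have := enorm_ge0 (h *: 'e_i + x).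
move: xh; rewrite ler_norml => /andP[l1 l2] e1 e2.
have nh := normr_ge0 h.
apply/andP; split.
- rewrite -(@ler_pXn2r _ 2)// ?nnegrE ?subr_ge0// sq sqrrB h2.
  rewrite lerD2r lerD2l mulrnAl -(mulr_natl _ 2) -mulrN; nra.
- rewrite -(@ler_pXn2r _ 2)// ?nnegrE ?addr_ge0// sq sqrrD h2.
  rewrite lerD2r lerD2l -(mulr_natl _ 2); nra.
Qed.

Lemma bounded_integrable (s t : R) (u : R -> R) (B : R) :
  measurable_fun [set: measurableTypeR R] u -> (forall r, `|u r| <= B) ->
  mu.-integrable `[s, t] (EFin \o u).
Proof.
move=> mu_ uB; apply: measurable_bounded_integrable => //.
- rewrite [X in (X < _)%E](lebesgue_measure_itv `[s, t]) /=.
  by case: ifP => // _; rewrite -EFinB ltry.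
- exact: measurable_funS mu_.
- exists B; split; first exact: num_real.
  by move=> y By r _; rewrite /= (le_trans (uB r))// ltW.
Qed.

Lemma Rintegral_bound (s t : R) (u : R -> R) (B : R) : s <= t ->
  measurable_fun [set: measurableTypeR R] u -> (forall r, `|u r| <= B) ->
  `|\int[mu]_(r in `[s, t]) u r| <= (t - s) * B.
Proof.
move=> st mu_ uB.
have iu := bounded_integrable s t mu_ uB.
have B_ge0 : 0 <= B := le_trans (normr_ge0 _) (uB 0).
apply: (le_trans (le_normr_Rintegral _ iu)) => //.
apply: (@le_trans _ _ (\int[mu]_(r in `[s, t]) B)).
  apply: le_Rintegral => //.
  - apply: (@bounded_integrable _ _ (fun r => `|u r|) B).
      by apply: measurableT_comp.
    by move=> r; rewrite normr_id.
  - by apply: (@bounded_integrable _ _ (cst B) B) => // r; rewrite /= ger0_norm.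
rewrite [leLHS](@Rintegral_cst _ _ _ mu)// mulrC.
rewrite [X in fine X](lebesgue_measure_itv `[s, t])/= lte_fin.
move: st; rewrite le_eqVlt => /orP[/eqP->|st]; first by rewrite ltxx subrr.
by rewrite st -EFinB.
Qed.

End derivatives_under_integral.

Section symbol_integral.
Context {R : realType} {n : nat}.
Local Notation mu := (@lebesgue_measure R).
Implicit Types (F : R -> 'rV[R]_n -> R[i]) (x : 'rV[R]_n).

Definition line_of (u : 'rV[R]_n -> R) x (i : 'I_n) (h : R) : R := u (h *: 'e_i + x).

Lemma line_neq0 x i (h : R) : `|h| < enorm x -> h *: 'e_i + x != 0.
Proof.
move=> hx; have /andP[+ _] := enorm_line i (ltW hx).
apply: contraTneq => ->; rewrite -ltNge.
rewrite (_ : enorm 0 = 0) ?subr_gt0// /enorm /dotp big1 ?sqrtr0// => j _.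
by rewrite mxE mul0r.
Qed.

Lemma derivable_lineE (u : 'rV[R]_n -> R) x i :
  derivable u x ('e_i : 'rV[R]_n) ->
  derivable (line_of u x i) 0 1 /\
  'D_('e_i : 'rV[R]_n) u x = 'D_1 (line_of u x i) 0.
Proof. by move=> /derivableP /is_derive_line[d1 d2]; split. Qed.

Lemma measurable_cpartial_param F x i : x != 0 ->
  (forall y, y != 0 -> cmeasurable (fun r : measurableTypeR R => F r y)) ->
  (forall r, cderivable (F r) x i) ->
  cmeasurable (fun r : measurableTypeR R => cpartial i (F r) x).
Proof.
move=> x0 mF dF.
have main (p : R[i] -> R) :
    (forall y, y != 0 -> measurable_fun setT (fun r : measurableTypeR R => p (F r y))) ->
    (forall r, derivable (fun y => p (F r y)) x ('e_i : 'rV[R]_n)) ->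
    measurable_fun setT (fun r : measurableTypeR R =>
      'D_('e_i : 'rV[R]_n) (fun y => p (F r y)) x).
  move=> mp dp.
  under eq_fun do rewrite (derivable_lineE (dp _)).2.
  apply: (@measurable_derive_line _ _ _ _
    (fun (r : measurableTypeR R) => line_of (fun y => p (F r y)) x i) (enorm x)).
  - exact: enorm_gt0.
  - by rewrite /line_of scale0r add0r; exact: mp.
  - move=> h /andP[h0 hx]; apply: mp; apply: line_neq0.
    by rewrite gtr0_norm.
  - by move=> r _; exact: (derivable_lineE (dp r)).1.
split; [apply: (main Re)|apply: (main Im)] => [y /mF[]//|r|y /mF[]//|r];
  by have [] := dF r.
Qed.

Lemma is_cpartial_integral F (s t : R) (M p : R) x i : 
  0 <= M -> x != 0 ->
  (forall y, y != 0 -> cmeasurable (fun r : measurableTypeR R => F r y)) ->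
  (forall r y, y != 0 -> cderivable (F r) y i) ->
  (forall y, y != 0 -> exists B, forall r, normc (F r y) <= B) ->
  (forall r y, y != 0 -> normc (cpartial i (F r) y) <= M * enorm y `^ p) ->
  is_cpartial (fun y => cintegral mu `[s, t] (fun r => F r y)) x i
    (cintegral mu `[s, t] (fun r => cpartial i (F r) x)).
Proof.
move=> M0 x0 mF dF bF bdF.
pose e := enorm x / 2.
have ex0 := enorm_gt0 x0.
have e0 : 0 < e by rewrite divr_gt0.
pose K := M * (e `^ p + (enorm x + e) `^ p).
have line_bound h : h \in `](- e), e[%R ->
    h *: 'e_i + x != 0 /\ enorm (h *: 'e_i + x) `^ p <= e `^ p + (enorm x + e) `^ p.
  rewrite in_itv /= => he; have {}he : `|h| < e by rewrite ltr_norml.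
  have hx : `|h| < enorm x by rewrite (lt_trans he)// /e ltr_pdivrMr// ltr_pMr// ltr1n.
  split; first exact: line_neq0.
  apply: powR_between => //; have /andP[l1 l2] := enorm_line i (ltW hx).
  rewrite (le_trans _ l1) ?(le_trans l2)//=; first by rewrite lerD2l ltW.
  by rewrite lerBrDr -lerBrDl (le_trans (ltW he))// /e; lra.
have main (q : R[i] -> R) (Dq : R -> 'rV[R]_n -> R) :
    (forall z, `|q z| <= normc z) ->
    (forall y, y != 0 -> measurable_fun setT (fun r : measurableTypeR R => q (F r y))) ->
    (forall r y, y != 0 -> is_derive y ('e_i : 'rV[R]_n) (fun y => q (F r y)) (Dq r y)) ->
    (forall r y, y != 0 -> `|Dq r y| <= M * enorm y `^ p) ->
    is_derive x ('e_i : 'rV[R]_n) (fun y => \int[mu]_(r in `[s, t]) q (F r y))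
      (\int[mu]_(r in `[s, t]) Dq r x).
  move=> qle mq dq Dqb; apply/is_derive_line.
  pose f (h : R) (r : measurableTypeR R) := q (F r (h *: 'e_i + x)).
  have der_f h r : h \in `](- e), e[%R ->
      is_derive h 1 (f ^~ r) (Dq r (h *: 'e_i + x)).
    move=> /line_bound[h0 _].
    exact: (@is_derive_line_shift _ _ (fun y => q (F r y)) x _ h _ (dq r _ h0)).
  have zero_in : `](- e), e[%classic (0 : R) by rewrite /= in_itv /= oppr_lt0 e0.
  have fint h : `](- e), e[%classic h -> mu.-integrable `[s, t] (EFin \o f h).
    move=> /line_bound[h0 _]; have [B FB] := bF _ h0.
    apply: (@bounded_integrable _ _ _ _ B); first exact: mq.
    by move=> r; rewrite (le_trans (qle _)).
  have fder h (r : measurableTypeR R) : `](- e), e[%classic h -> `[s, t]%classic r ->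
      derivable (f ^~ r) h 1.
    by move=> hI _; have [] := der_f h r hI.
  have Kint : mu.-integrable `[s, t] (EFin \o (cst K : measurableTypeR R -> R)).
    by apply: (@bounded_integrable _ _ _ (cst K) `|K|).
  have K0 (r : measurableTypeR R) : 0 <= (cst K : measurableTypeR R -> R) r.
    by rewrite /= mulr_ge0// addr_ge0// powR_ge0.
  have fub h (r : measurableTypeR R) : `](- e), e[%classic h -> `[s, t]%classic r ->
      `|partial1of2 f h r| <= (cst K : measurableTypeR R -> R) r.
    move=> hI _; rewrite partial1of2E.
    have [h0 hle] := line_bound h hI.
    have [_ ->] := der_f h r hI.
    by rewrite (le_trans (Dqb _ _ h0))//= ler_wpM2l.
  have mI : measurable (`[s, t]%classic : set (measurableTypeR R)) by [].
  have d1 := derivable_under_integral mI zero_in fint fder K0 Kint fub.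
  have d2 := differentiation_under_integral mI zero_in fint fder K0 Kint fub.
  apply: DeriveDef; first exact: d1.
  rewrite -derive1E [LHS]d2; apply: eq_Rintegral => r _.
  rewrite partial1of2E; have [_ ->] := der_f 0 r zero_in.
  by rewrite scale0r add0r.
split.
- apply: (main Re (fun r y => Re (cpartial i (F r) y))).
  + exact: normr_Re_le.
  + by move=> y /mF[].
  + by move=> r y y0; have [] := cderivableP (dF r y y0).
  + by move=> r y y0; rewrite (le_trans (normr_Re_le _))// bdF.
- apply: (main Im (fun r y => Im (cpartial i (F r) y))).
  + exact: normr_Im_le.
  + by move=> y /mF[].
  + by move=> r y y0; have [] := cderivableP (dF r y y0).
  + by move=> r y y0; rewrite (le_trans (normr_Im_le _))// bdF.
Qed.

Lemma symb_integral l F (s t M p : R) : s <= t -> 0 <= M ->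
  (forall r, symb l (fun x => M * enorm x `^ p) (F r)) ->
  (forall x, x != 0 -> cmeasurable (fun r : measurableTypeR R => F r x)) ->
  symb l (fun x => 2 * (t - s) * (M * enorm x `^ p))
    (fun x => cintegral mu `[s, t] (fun r => F r x)).
Proof.
move=> st M0; elim: l F p => [|i l IH] F p Fg mF.
  move=> x x0; rewrite (le_trans (normc_le_ReIm _))//.
  rewrite -mulrA mulr_natl mulr2n lerD//.
    apply: Rintegral_bound => //; first by have [] := mF x x0.
    by move=> r; rewrite (le_trans (normr_Re_le _))// Fg.
  apply: Rintegral_bound => //; first by have [] := mF x x0.
  by move=> r; rewrite (le_trans (normr_Im_le _))// Fg.
have enorm_powRB1 x : x != 0 -> enorm x `^ p * (enorm x)^-1 = enorm x `^ (p - 1).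
  move=> x0; rewrite powRB ?powRr1 ?enorm_ge0//.
  by apply/implyP => _; rewrite gt_eqF ?enorm_gt0.
have dFg r : symb l (fun x => M * enorm x `^ (p - 1)) (cpartial i (F r)).
  by have [_ _] := Fg r; apply: le_symb => x x0; rewrite -mulrA enorm_powRB1.
have dF r x : x != 0 -> cderivable (F r) x i by have [_ + _] := Fg r; exact.
apply: (@symb_cons _ _ _ _ _ _
    (fun x => cintegral mu `[s, t] (fun r => cpartial i (F r) x))).
- by apply: IH => // r; have [] := Fg r.
- move=> x x0; apply: (@is_cpartial_integral _ _ _ M (p - 1)) => //.
    move=> y y0; exists (M * enorm y `^ p) => r.
    by have [h _ _] := Fg r; exact: symb_bound h _ y0.
  by move=> r y y0; exact: symb_bound (dFg r) _ y0.
- apply: le_symb (IH _ _ dFg _) => x x0.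
    by rewrite -!mulrA enorm_powRB1// !mulrA.
  by apply: measurable_cpartial_param => // r; exact: dF.
Qed.

End symbol_integral.

Section integrable_majorant.
Context {R : realType}.

Definition weight (gamma nu c p : R) (k : nat) (rho : R) : R :=
  rho `^ p * ((1 + c * rho `^ gamma) ^+ k * expR (- nu * rho `^ gamma)).

Lemma poly_exp_bounded (gamma nu c r : R) (m : nat) :
  0 < gamma -> 0 < nu -> 0 <= c -> 0 <= r ->
  exists2 C : R, 0 <= C & forall rho : R, 0 < rho ->
    weight gamma nu c r m rho <= C.
Proof.
move=> gamma0 nu0 c0 r0.
pose N0 := (Num.truncn (r / gamma)).+1; pose K := (N0 + m)%N.
pose A := 1 + K%:R / nu.
have K0 : 0 < K%:R :> R by rewrite ltr0n /K /N0 addSn.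
have A1 : 1 <= A by rewrite lerDl divr_ge0// ltW.
have A0 : 0 <= A := le_trans ler01 A1.
exists ((1 + c) ^+ m * A ^+ K); first by rewrite mulr_ge0// exprn_ge0// addr_ge0.
move=> rho rho0; rewrite /weight; set y := rho `^ gamma.
have y0 : 0 <= y by exact: powR_ge0.
have -> : rho `^ r = y `^ (r / gamma).
  by rewrite -powRrM mulrCA divff ?mulr1// gt_eqF.
have h1 : y `^ (r / gamma) <= (1 + y) ^+ N0.
  rewrite (@le_trans _ _ ((1 + y) `^ (r / gamma)))//.
    by rewrite ge0_ler_powR ?nnegrE ?divr_ge0 ?addr_ge0 ?(ltW gamma0)// lerDr.
  rewrite -powR_mulrn ?addr_ge0// ler_powR ?lerDl//.
  by rewrite ltW// truncnS_gt.
have h2 : (1 + c * y) ^+ m <= (1 + c) ^+ m * (1 + y) ^+ m.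
  by rewrite -exprMn lerXn2r// ?nnegrE ?addr_ge0 ?mulr_ge0 ?addr_ge0//; nra.
have h3 : (1 + y) ^+ K <= A ^+ K * expR (nu * y).
  have -> : nu * y = K%:R * (nu * y / K%:R) by rewrite mulrCA divff ?mulr1// gt_eqF.
  rewrite expRM_natl mulrC -exprMn.
  rewrite lerXn2r ?nnegrE ?addr_ge0 ?mulr_ge0 ?expR_ge0//.
  rewrite (@le_trans _ _ ((1 + nu * y / K%:R) * A))//; last first.
    by rewrite ler_wpM2r// expR_ge1Dx.
  have -> : (1 + nu * y / K%:R) * A = A + nu * y / K%:R * A by ring.
  rewrite lerD//.
  have e : nu * y / K%:R * (K%:R / nu) = y by field; rewrite !gt_eqF.
  by rewrite -[leLHS]e ler_wpM2l ?divr_ge0 ?mulr_ge0 ?(ltW nu0)// lerDr.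
apply: (@le_trans _ _
  ((1 + y) ^+ N0 * (((1 + c) ^+ m * (1 + y) ^+ m) * expR (- nu * y)))).
  rewrite ler_pM ?powR_ge0 ?mulr_ge0 ?expR_ge0 ?exprn_ge0 ?addr_ge0 ?mulr_ge0//.
  by rewrite ler_wpM2r ?expR_ge0.
rewrite (_ : _ * _ = (1 + c) ^+ m * ((1 + y) ^+ K * expR (- nu * y))); last first.
  by rewrite /K exprD; ring.
rewrite ler_wpM2l ?exprn_ge0 ?addr_ge0//.
by rewrite mulNr expRN ler_pdivrMr ?expR_gt0.
Qed.

Lemma dyadic_floor (y : R) : 1 <= y -> exists k : nat, 2 ^+ k <= y < 2 ^+ k.+1.
Proof.
move=> y1.
have ex : exists k : nat, y < 2 ^+ k.+1.
  exists (Num.truncn y); rewrite (lt_le_trans (truncnS_gt y))//.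
  by rewrite -natrX ler_nat ltnW// ltn_expl.
exists (ex_minn ex); case: ex_minnP => -[|k] -> kmin; rewrite ?andbT ?expr0//.
by rewrite leNgt; apply/negP => /kmin; rewrite ltnn.
Qed.

Variable n : nat.
Local Notation mun := (@lebesgue_Rn R n).

Definition box (r : R) : set (Rn R n) := [set t | forall i, tnth t i \in `[- r, r]%R].

Lemma measurable_box r : measurable (box r).
Proof.
have -> : box r = \bigcap_(i in [set: 'I_n]) [set t | tnth t i \in `[- r, r]%R].
  by apply/seteqP; split=> t /= h i; [move=> _; exact: h|exact: h].
apply: fin_bigcap_measurable => // i _.
rewrite -[X in measurable X]setTI.
have mI : measurable (`[(- r), r]%classic : set (measurableTypeR R)) by [].
exact: (@measurable_tnth _ (measurableTypeR R) n i measurableT _ mI).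
Qed.

Lemma lebesgue_box r : 0 <= r -> mun (box r) = ((2 * r) ^+ n)%:E.
Proof.
move=> r0.
have side : lebesgue_measure (`[(- r), r]%classic : set (measurableTypeR R)) = (2 * r)%:E.
  rewrite [LHS](lebesgue_measure_itv `[(- r), r]) /= lte_fin.
  move: r0; rewrite le_eqVlt => /orP[/eqP<-|r0]; first by rewrite oppr0 ltxx mulr0.
  by rewrite gt0_cp// -EFinB opprK -mulr2n mulr_natl.
rewrite [LHS](@lebesgue_Rn_box R n (fun=> `[(- r), r]%classic))//.
under eq_bigr => i _.
  rewrite side. over.
by rewrite -(big_morph EFin (@EFinM R) (erefl 1%:E)) /= prodr_const card_ord.
Qed.

Lemma integral_dyadic_sum (a r : nat -> R) (K theta : R) :
  (forall k, 0 <= a k) -> (forall k, 0 <= r k) -> 0 <= theta < 1 ->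
  (forall k, a k * (2 * r k) ^+ n <= K * theta ^+ k) ->
  (\int[mun]_t (\sum_(k <oo) (a k * \1_(box (r k)) t)%:E) <= (K / (1 - theta))%:E)%E.
Proof.
move=> a0 r0 /andP[theta0 theta1] ar.
have K0 : 0 <= K.
  have := ar 0; rewrite expr0 mulr1; apply: le_trans.
  by rewrite mulr_ge0// exprn_ge0// mulr_ge0.
have mind k : measurable_fun [set: Rn R n] (EFin \o (\1_(box (r k)) : Rn R n -> R)).
  by apply/measurable_EFinP; apply: measurable_indic; exact: measurable_box.
rewrite integral_nneseries//; last first.
- by move=> k t _; rewrite lee_fin mulr_ge0.
- move=> k; under eq_fun do rewrite EFinM.
  by apply: emeasurable_funM => //; exact: mind.
apply: lime_le.
  apply: is_cvg_nneseries => k _ _; apply: integral_ge0 => t _.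
  by rewrite lee_fin mulr_ge0.
apply: nearW => N.
apply: (@le_trans _ _ (\sum_(0 <= k < N) (K * theta ^+ k)%:E)%E).
  apply: lee_sum => k _.
  under eq_integral do rewrite EFinM.
  rewrite ge0_integralZl_EFin//; last exact: mind.
  rewrite integral_indic//; last exact: measurable_box.
  rewrite [X in (_ * X)%E](_ : _ = ((2 * r k) ^+ n)%:E); last first.
    by rewrite setIT; exact: lebesgue_box.
  by rewrite -EFinM lee_fin.
rewrite sumEFin lee_fin big_mkord -mulr_sumr ler_wpM2l// -div1r ler_pdivlMr ?subr_gt0//.
rewrite mulrC -opprB mulNr -subrX1 opprB gerBl exprn_ge0//.
Qed.

Lemma null_origin : (0 < n)%N -> {ae mun, forall t, row_of t != 0}.
Proof.
move=> n0; exists (box 0); split; first exact: measurable_box.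
  by rewrite lebesgue_box// mulr0 expr0n gtn_eqF.
move=> t /= /negP; rewrite negbK => /eqP t0 i.
by rewrite in_itv /= oppr0 -eq_le; have /rowP/(_ i) := t0; rewrite !mxE => ->.
Qed.

Lemma row_of_box (t : Rn R n) r : enorm (row_of t) <= r -> box r t.
Proof.
move=> tr i; rewrite in_itv /= -ler_norml (le_trans _ tr)//.
by have := coord_le_enorm (row_of t) i; rewrite mxE.
Qed.

(* Dyadic decomposition: a point with [2^-(k+1) < |x| <= 2^-k], resp.
   [2^k <= |x| < 2^(k+1)], lies in a box of half-side [2^-k], resp. [2^(k+1)], and
   the two resulting series are geometric with ratios [2^-(q+n)] and [1/2]. *)
Lemma integral_two_powers (q C : R) : (0 < n)%N -> - n%:R < q < 0 -> 0 <= C ->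
  exists N : R, forall u : Rn R n -> \bar R, measurable_fun setT u ->
    (forall t, 0 <= u t)%E ->
    (forall t, row_of t != 0%R -> u t <= (C * enorm (row_of t) `^ q)%:E)%E ->
    (forall t, row_of t != 0%R ->
       u t <= (C * enorm (row_of t) `^ (- n.+1%:R))%:E)%E ->
    (\int[mun]_t u t <= N%:E)%E.
Proof.
move=> n0 /andP[nq q0] C0.
pose a k : R := C * (2 ^+ k.+1) `^ (- q).
pose r k : R := (2 ^+ k)^-1.
pose b k : R := C * (2 ^+ k) `^ (- n.+1%:R).
pose r' k : R := 2 ^+ k.+1.
pose th : R := 2 `^ (- q - n%:R).
have th01 : 0 <= th < 1.
  rewrite powR_ge0 /= /th -[ltRHS](powRr0 2) /powR !gt_eqF// ltr_expR.
  by rewrite mul0r pmulr_llt0 ?ln_gt0 ?ltr1n//; lra.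
have half01 : 0 <= (2^-1 : R) < 1 by apply/andP; split; lra.
have a0 k : 0 <= a k by rewrite mulr_ge0// powR_ge0.
have b0 k : 0 <= b k by rewrite mulr_ge0// powR_ge0.
have r0 k : 0 <= r k by rewrite invr_ge0 exprn_ge0.
have r'0 k : 0 <= r' k by rewrite exprn_ge0.
have arE k : a k * (2 * r k) ^+ n <= C * 2 `^ (- q) * 2 ^+ n * th ^+ k.
  rewrite le_eqVlt; apply/orP; left; apply/eqP.
  rewrite /a /r /th exprS powRM ?exprn_ge0// exprMn.
  rewrite powRB; last by apply/implyP => _; rewrite pnatr_eq0.
  rewrite powR_mulrn// -(powR_mulrn k)// -powRrM (mulrC k%:R) powRrM.
  rewrite !powR_mulrn ?powR_ge0//.
  by rewrite !exprMn !exprVn -!exprM (mulnC k n); set X := (2 ^+ (n * k)%N)^-1; ring.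
have brE k : b k * (2 * r' k) ^+ n <= C * 4 ^+ n * 2^-1 ^+ k.
  rewrite le_eqVlt; apply/orP; left; apply/eqP.
  have e1 : (2 * 2 ^+ k.+1) ^+ n = 4 ^+ n * (2 ^+ k) ^+ n :> R.
    by rewrite -exprMn exprS mulrA -natrM.
  have h1 : (2 ^+ k) ^+ n != 0 :> R by rewrite !expf_neq0 ?pnatr_eq0.
  have h2 : 2 ^+ k != 0 :> R by rewrite !expf_neq0 ?pnatr_eq0.
  rewrite /b /r' e1 powR_invn ?exprn_ge0// [(2 ^+ k) ^+ n.+1]exprS exprVn.
  by move: h1 h2; set X := _ ^+ n; set Y := 2 ^+ k => h1 h2; field; rewrite h1 h2.
pose w1 t := (\sum_(k <oo) (a k * \1_(box (r k)) t)%:E)%E.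
pose w2 t := (\sum_(k <oo) (b k * \1_(box (r' k)) t)%:E)%E.
have mw (c s : nat -> R) : (forall k, 0 <= c k) ->
    measurable_fun setT (fun t : Rn R n => \sum_(k <oo) (c k * \1_(box (s k)) t)%:E)%E.
  move=> c0; apply: ge0_emeasurable_sum => [k t _ _|k _].
    by rewrite lee_fin mulr_ge0.
  apply/measurable_EFinP; apply: measurable_funM => //.
  by apply: measurable_indic; exact: measurable_box.
have w_ge0 (c s : nat -> R) t : (forall k, 0 <= c k) ->
    (0 <= \sum_(k <oo) (c k * \1_(box (s k)) t)%:E)%E.
  by move=> c0; apply: nneseries_ge0 => k _ _; rewrite lee_fin mulr_ge0.
have w_ge (c s : nat -> R) t k : (forall k, 0 <= c k) -> box (s k) t ->
    ((c k)%:E <= \sum_(k <oo) (c k * \1_(box (s k)) t)%:E)%E.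
  move=> c0 st; apply: (@le_trans _ _ (\sum_(0 <= j < k.+1) (c j * \1_(box (s j)) t)%:E)%E).
    rewrite big_nat_recr//= indicE mem_set// mulr1 leeDr//.
    by apply: sume_ge0 => j _; rewrite lee_fin mulr_ge0.
  by apply: nneseries_lim_ge => j _ _; rewrite lee_fin mulr_ge0.
exists (C * 2 `^ (- q) * 2 ^+ n / (1 - th) + C * 4 ^+ n / (1 - 2^-1)).
move=> u mu_ u0 u1 u2.
apply: (@le_trans _ _ (\int[mun]_t (w1 t + w2 t))%E); last first.
  rewrite ge0_integralD//; [|by move=> t _; exact: w_ge0|exact: mw
    |by move=> t _; exact: w_ge0|exact: mw].
  by rewrite EFinD leeD// integral_dyadic_sum.
apply: ae_ge0_le_integral => //.
- by move=> t _; rewrite adde_ge0//; exact: w_ge0.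
- by apply: emeasurable_funD; exact: mw.
apply: filterS (null_origin n0) => t t0 _.
have e0 := enorm_gt0 t0; set e := enorm _ in e0.
have [e1|e1] := leP e 1.
- have [k /andP[k1 k2]] : exists k : nat, 2 ^+ k <= e^-1 < 2 ^+ k.+1.
    by apply: dyadic_floor; rewrite invf_ge1.
  apply: (@le_trans _ _ (w1 t)); last by rewrite leeDl// w_ge0.
  apply: (@le_trans _ _ (a k)%:E).
    apply: le_trans (u1 t t0) _; rewrite lee_fin ler_wpM2l//.
    rewrite -[in leLHS](invrK (enorm _)) -[q]opprK.
    rewrite -[leLHS]/((e^-1)^-1 `^ - - q) -powR_inv1 ?invr_ge0 ?(ltW e0)// -powRrM.
    rewrite mulN1r opprK ge0_ler_powR ?nnegrE ?oppr_ge0 ?invr_ge0 ?exprn_ge0//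
      ?(ltW e0) ?(ltW q0) ?(ltW k2)//.
  apply: w_ge => //; apply: row_of_box.
  by rewrite -[leLHS]invrK lef_pV2 ?posrE ?invr_gt0 ?exprn_gt0.
- have [k /andP[k1 k2]] := dyadic_floor (ltW e1).
  apply: (@le_trans _ _ (w2 t)); last by rewrite leeDr// w_ge0.
  apply: (@le_trans _ _ (b k)%:E).
    apply: le_trans (u2 t t0) _; rewrite lee_fin ler_wpM2l//.
    rewrite -/e !powRN lef_pV2 ?posrE ?powR_gt0 ?exprn_gt0//.
    by rewrite ge0_ler_powR ?nnegrE ?exprn_ge0 ?(ltW e0).
  by apply: w_ge => //; apply: row_of_box; exact: ltW.
Qed.

Lemma integral_symbol_weight (gamma nu c p K : R) (m : nat) : (0 < n)%N ->
  0 < gamma -> 0 < nu -> 0 <= c -> 0 <= K -> - n%:R < p ->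
  exists N : R, forall u : Rn R n -> \bar R, measurable_fun setT u ->
    (forall t, 0 <= u t)%E ->
    (forall t, row_of t != 0%R ->
       u t <= (K * weight gamma nu c p m (enorm (row_of t)))%:E)%E ->
    (\int[mun]_t u t <= N%:E)%E.
Proof.
move=> n0 gamma0 nu0 c0 K0 np.
have nR : 0 < n%:R :> R by rewrite ltr0n.
pose q := Num.min p (- n%:R / 2).
have [qp qn] : q <= p /\ q <= - n%:R / 2 by rewrite /q !ge_min !lexx orbT.
have nq : - n%:R < q < 0.
  by rewrite lt_min np /=; apply/andP; split; lra.
have pq0 : 0 <= p - q by rewrite subr_ge0.
have pn0 : 0 <= p + n.+1%:R by rewrite -natr1; lra.
have [C1 C10 H1] := poly_exp_bounded m gamma0 nu0 c0 pq0.
have [C2 C20 H2] := poly_exp_bounded m gamma0 nu0 c0 pn0.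
have CC0 : 0 <= K * (C1 + C2) by rewrite mulr_ge0// addr_ge0.
have [N HN] := integral_two_powers n0 nq CC0.
exists N => u mu_ u0 uK; apply: HN => // t t0; apply: le_trans (uK t t0) _;
  have e0 := enorm_gt0 t0; rewrite lee_fin -mulrA /weight ler_wpM2l//.
- have -> : enorm (row_of t) `^ p = enorm (row_of t) `^ (p - q) * enorm (row_of t) `^ q.
    by rewrite -powRD ?subrK//; apply/implyP => _; rewrite gt_eqF.
  rewrite -mulrA mulrCA mulrC ler_wpM2r ?powR_ge0// (le_trans (H1 _ e0))// lerDl//.
- have -> : enorm (row_of t) `^ p =
      enorm (row_of t) `^ (p + n.+1%:R) * enorm (row_of t) `^ (- n.+1%:R).
    by rewrite -powRD ?addrK//; apply/implyP => _; rewrite gt_eqF.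
  rewrite -mulrA mulrCA mulrC ler_wpM2r ?powR_ge0// (le_trans (H2 _ e0))// lerDr//.
Qed.

End integrable_majorant.

Section measurability.
Context {R : realType} {n : nat}.
Local Notation mu := (@lebesgue_measure R).

Lemma measurable_row_coord i :
  measurable_fun setT (fun t : Rn R n => row_of t ord0 i).
Proof.
rewrite (_ : (fun _ => _) = (fun t : Rn R n => tnth t i)); last first.
  by apply/funext => t; rewrite mxE.
exact: (@measurable_tnth _ (measurableTypeR R) n i).
Qed.

Definition affine (c h : R) (i : 'I_n) (t : Rn R n) : Rn R n :=
  [tuple c * tnth t j + h * (i == j)%:R | j < n].

Lemma row_of_affine c h i t :
  row_of (affine c h i t) = c *: row_of t + h *: 'e_i.
Proof. by apply/rowP => j; rewrite !mxE tnth_mktuple eqxx /= (eq_sym j). Qed.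

Lemma measurable_affine c h i : measurable_fun setT (affine c h i).
Proof.
apply/measurable_fun_tnthP => j.
rewrite (_ : _ \o _ = (fun t : Rn R n => c * row_of t ord0 j + h * (i == j)%:R)).
  apply: measurable_funD => //; apply: measurable_funM => //.
  exact: measurable_row_coord.
by apply/funext => t; rewrite /= tnth_mktuple mxE.
Qed.

Lemma measurable_row_dotp x : measurable_fun setT (fun t : Rn R n => dotp (row_of t) x).
Proof.
apply: measurable_sum => i; apply: measurable_funM => //; exact: measurable_row_coord.
Qed.

Lemma measurable_row_enorm : measurable_fun setT (fun t : Rn R n => enorm (row_of t)).
Proof.
apply: (@measurableT_comp _ _ _ _ _ _ (@Num.sqrt R)).
  by apply: continuous_measurable_fun; exact: sqrt_continuous.
by apply: measurable_sum => i; apply: measurable_funM; exact: measurable_row_coord.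
Qed.

Lemma cmeasurableM d (T : measurableType d) (f g : T -> R[i]) :
  cmeasurable f -> cmeasurable g -> cmeasurable (fun x => f x * g x).
Proof.
move=> [f1 f2] [g1 g2]; split.
  by under eq_fun do rewrite ReM; apply: measurable_funB; apply: measurable_funM.
by under eq_fun do rewrite ImM; apply: measurable_funD; apply: measurable_funM.
Qed.

Lemma cmeasurable_cst d (T : measurableType d) (c : R[i]) :
  cmeasurable (fun _ : T => c).
Proof. by split; exact: measurable_cst. Qed.

Lemma cmeasurableX d (T : measurableType d) (f : T -> R[i]) k :
  cmeasurable f -> cmeasurable (fun x => f x ^+ k).
Proof.
move=> mf; elim: k => [|k IH]; first exact: cmeasurable_cst.
by under eq_fun do rewrite exprS; exact: cmeasurableM.
Qed.

Lemma cmeasurable_real d (T : measurableType d) (f : T -> R) :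
  measurable_fun setT f -> cmeasurable (fun x => (f x)%:C).
Proof. by move=> mf; split => //=; exact: measurable_cst. Qed.

Lemma cmeasurable_cexp d (T : measurableType d) (f : T -> R[i]) :
  cmeasurable f -> cmeasurable (fun x => cexp (f x)).
Proof.
move=> [f1 f2]; split; apply: measurable_funM.
- exact: (@measurableT_comp _ _ _ _ _ _ (@expR R)).
- apply: (@measurableT_comp _ _ _ _ _ _ (@cos R)) => //.
  by apply: continuous_measurable_fun; exact: continuous_cos.
- exact: (@measurableT_comp _ _ _ _ _ _ (@expR R)).
- apply: (@measurableT_comp _ _ _ _ _ _ (@sin R)) => //.
  by apply: continuous_measurable_fun; exact: continuous_sin.
Qed.

Lemma cmeasurable_comp d d' (T : measurableType d) (T' : measurableType d')
    (f : T' -> R[i]) (g : T -> T') :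
  cmeasurable f -> measurable_fun setT g -> cmeasurable (f \o g).
Proof.
move=> [f1 f2] mg; split.
  exact: (@measurableT_comp _ _ _ _ _ _ (fun x => Re (f x))).
exact: (@measurableT_comp _ _ _ _ _ _ (fun x => Im (f x))).
Qed.

Lemma measurable_Rintegral_param d (T : measurableType d) (D : set (measurableTypeR R))
    (f : T * measurableTypeR R -> R) : measurable D -> measurable_fun setT f ->
  measurable_fun setT (fun x => \int[mu]_(r in D) f (x, r)).
Proof.
move=> mD mf.
have ge0 (g : T * measurableTypeR R -> \bar R) : (forall p, 0 <= g p)%E ->
    measurable_fun setT g ->
    measurable_fun setT (fun x => (\int[mu]_(r in D) g (x, r))%E).
  move=> g0 mg.
  under eq_fun do rewrite integral_mkcond.
  pose h (p : T * measurableTypeR R) : \bar R := (g p * (\1_D p.2)%:E)%E.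
  have mh : measurable_fun setT h.
    apply: emeasurable_funM => //; apply/measurable_EFinP.
    apply: (@measurableT_comp _ _ _ _ _ _ (\1_D : measurableTypeR R -> R)) => //.
  have h0 p : (0 <= h p)%E by rewrite mule_ge0// lee_fin.
  apply: (eq_measurable_fun (fubini_F mu h)); last first.
    exact: measurable_fun_fubini_tonelli_F.
  move=> x _; rewrite /fubini_F; apply: eq_integral => r _.
  by rewrite /h patchE indicE /=; case: ifP => _; rewrite ?mule1 ?mule0.
rewrite /Rintegral.
apply: (@measurableT_comp _ _ _ _ _ _ (@fine R)) => //.
under eq_fun do rewrite integralE.
apply: emeasurable_funB.
- have h : measurable_fun setT (fun x => (\int[mu]_(r in D) (EFin \o f)^\+ (x, r))%E).
    by apply: ge0 => //; apply: measurable_funepos; exact/measurable_EFinP.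
  by apply: eq_measurable_fun h => x _; apply: eq_integral => r _; rewrite !funeposE.
- have h : measurable_fun setT (fun x => (\int[mu]_(r in D) (EFin \o f)^\- (x, r))%E).
    by apply: ge0 => //; apply: measurable_funeneg; exact/measurable_EFinP.
  by apply: eq_measurable_fun h => x _; apply: eq_integral => r _; rewrite !funenegE.
Qed.

Lemma cmeasurable_cpartial (f : 'rV[R]_n -> R[i]) i :
  cmeasurable (fun t : Rn R n => f (row_of t)) ->
  (forall x, x != 0 -> cderivable f x i) ->
  cmeasurable (fun t : Rn R n => cpartial i f (row_of t)).
Proof.
move=> mf df.
pose U := [set t : Rn R n | row_of t != 0].
have CU : ~` U = box 0.
  apply/seteqP; split=> t /=.
    by move=> /negP; rewrite negbK => /eqP t0; apply: row_of_box; rewrite t0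
      /enorm /dotp big1 ?sqrtr0// => j _; rewrite mxE mul0r.
  move=> t0; apply/negP; rewrite negbK; apply/eqP/rowP => j; rewrite !mxE.
  by have := t0 j; rewrite in_itv /= oppr0 -eq_le eq_sym => /eqP.
have mCU : measurable (~` U) by rewrite CU; exact: measurable_box.
have mU : measurable U by rewrite -[U]setCK; exact: measurableC.
have main (u : 'rV[R]_n -> R) : measurable_fun setT (fun t : Rn R n => u (row_of t)) ->
    (forall x, x != 0 -> derivable u x ('e_i : 'rV[R]_n)) ->
    measurable_fun setT (fun t : Rn R n => 'D_('e_i : 'rV[R]_n) u (row_of t)).
  move=> mu_ du; rewrite -(setUv U); apply/measurable_funU => //; split.
  - apply: (eq_measurable_fun (fun t : Rn R n => 'D_1 (line_of u (row_of t) i) 0)).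
      by move=> t; rewrite inE => tU; rewrite (derivable_lineE (du _ tU)).2.
    apply: (@measurable_derive_line _ _ _ _
      (fun t : Rn R n => line_of u (row_of t) i) 1) => //.
    + rewrite /line_of; under eq_fun do rewrite scale0r add0r.
      exact: measurable_funS mu_.
    + move=> h _; apply: (@measurable_funS _ _ _ _ setT) => //.
      rewrite (_ : (fun _ => _) = (fun t => u (row_of t)) \o affine 1 h i).
        by apply: measurableT_comp => //; exact: measurable_affine.
      by apply/funext => t; rewrite /line_of /= row_of_affine scale1r addrC.
    + by move=> t tU; exact: (derivable_lineE (du _ tU)).1.
  - apply: (eq_measurable_fun (cst ('D_('e_i : 'rV[R]_n) u 0))) => //.
    by move=> t; rewrite inE /= => /negP; rewrite negbK => /eqP ->.
case: mf => mf1 mf2; split.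
- by apply: (main (fun y => Re (f y))) => // x /df[].
- by apply: (main (fun y => Im (f y))) => // x /df[].
Qed.

Lemma cmeasurable_mderive (f : 'rV[R]_n -> R[i]) alpha :
  cmeasurable (fun t : Rn R n => f (row_of t)) ->
  mderivable [set x | x != 0] alpha f ->
  cmeasurable (fun t : Rn R n => mderive alpha f (row_of t)).
Proof.
rewrite /mderivable /mderive => mf; elim: (mseq alpha) => //= i s IH [/IH ms ds].
exact: cmeasurable_cpartial.
Qed.

End measurability.

Section inverse_fourier_bound.
Context {R : realType} {n : nat}.
Local Notation mun := (@lebesgue_Rn R n).

Lemma inv_fourier_bounded (gamma nu c p K : R) (k : nat) : (0 < n)%N ->
  0 < gamma -> 0 < nu -> 0 <= c -> 0 <= K -> - n%:R < p ->
  exists N : R, forall f : 'rV[R]_n -> R[i],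
    cmeasurable (fun t : Rn R n => f (row_of t)) ->
    (forall x, x != 0 -> normc (f x) <= K * weight gamma nu c p k (enorm x)) ->
    cintegrable mun setT (fun t => f (row_of t)) /\
    forall x, normc (inv_fourier f x) <= N.
Proof.
move=> n0 gamma0 nu0 c0 K0 np.
have [N HN] := @integral_symbol_weight R n gamma nu c p K k n0 gamma0 nu0 c0 K0 np.
have main (v : Rn R n -> R) : measurable_fun setT v ->
    (forall t, row_of t != 0 -> `|v t| <= K * weight gamma nu c p k (enorm (row_of t))) ->
    mun.-integrable setT (EFin \o v) /\ `|\int[mun]_t v t| <= N.
  move=> mv vb.
  have le : (\int[mun]_t `|(EFin \o v) t| <= N%:E)%E.
    apply: HN => [|t|t t0] //; last by rewrite lee_fin vb.
    by apply: measurableT_comp => //; exact/measurable_EFinP.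
  have iv : mun.-integrable setT (EFin \o v).
    apply/integrableP; split; first exact/measurable_EFinP.
    by apply: le_lt_trans le _; rewrite ltry.
  split => //; apply: le_trans (le_normr_Rintegral measurableT iv) _.
  rewrite /Rintegral -lee_fin fineK//.
  rewrite ge0_fin_numE; last by apply: integral_ge0 => t _; rewrite lee_fin.
  by apply: le_lt_trans le _; rewrite ltry.
exists (`|((2 * pi) ^+ n)^-1| * (N + N)) => f mf fb; split.
  split; [apply: (main _ mf.1 _).1|apply: (main _ mf.2 _).1] => t t0;
    rewrite (le_trans _ (fb _ t0))//; [exact: normr_Re_le|exact: normr_Im_le].
move=> x; rewrite /inv_fourier normcM normc_real ler_wpM2l//.
rewrite (le_trans (normc_le_ReIm _))//.
pose g (t : Rn R n) := cexp (0 +i* dotp (row_of t) x) * f (row_of t).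
have mg : cmeasurable g.
  apply: cmeasurableM mf; apply: cmeasurable_cexp; split => /=.
    exact: measurable_cst.
  exact: measurable_row_dotp.
have gb t : row_of t != 0 -> normc (g t) <= K * weight gamma nu c p k (enorm (row_of t)).
  by move=> t0; rewrite /g normcM normc_cexp /= expR0 mul1r fb.
rewrite lerD//; [apply: (main _ mg.1 _).2|apply: (main _ mg.2 _).2] => t t0;
  rewrite (le_trans _ (gb _ t0))//; [exact: normr_Re_le|exact: normr_Im_le].
Qed.

End inverse_fourier_bound.

Section symbol_estimates.
Context {R : realType} {d : nat}.
Local Notation mu := (@lebesgue_measure R).
Variables (gamma nu : R) (psi : R -> 'rV[R]_d -> R[i]).
Hypotheses (gamma_gt0 : 0 < gamma) (nu_gt0 : 0 < nu).
Hypothesis psiP : symbol_assumption gamma nu psi.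
Variable alpha : 'I_d -> nat.
Hypothesis alpha_le : (mlen alpha <= (d %/ 2).+1)%N.
Variables s t : R.
Hypothesis st : s < t.

Let l := rev (mseq alpha).
Let tau_gt0 : 0 < t - s. Proof. by rewrite subr_gt0. Qed.
Let c := (t - s) `^ (- gamma^-1).
Let c_gt0 : 0 < c. Proof. exact: powR_gt0. Qed.

Definition phase (x : 'rV[R]_d) : R[i] :=
  cintegral mu `[s, t] (fun r => psi r (rescale gamma s t x)).

Lemma size_rev_mseq : size l = mlen alpha.
Proof. by rewrite size_rev size_mseq. Qed.

Lemma enorm_rescale (x : 'rV[R]_d) : enorm (rescale gamma s t x) `^ gamma =
  (t - s)^-1 * enorm x `^ gamma.
Proof.
rewrite /rescale enormZ ?powR_ge0// powRM ?powR_ge0 ?enorm_ge0// -powRrM.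
by rewrite mulNr mulVf ?gt_eqF// powR_inv1 ?ltW.
Qed.

Lemma rescale_neq0 (x : 'rV[R]_d) : x != 0 -> rescale gamma s t x != 0.
Proof. by move=> x0; rewrite scaler_eq0 negb_or gt_eqF. Qed.

Lemma symb_psi r : symb l (fun x => nu^-1 * enorm x `^ gamma) (psi r).
Proof.
apply: mseq_symb => beta ba; have bd := leq_trans ba alpha_le; split.
  exact: symbol_derivable psiP _ _ bd.
move=> x x0; apply: le_trans (symbol_regular psiP r x0 bd) _.
rewrite -mulrA ler_wpM2l ?invr_ge0 ?(ltW nu_gt0)// powRB.
  by rewrite powR_mulrn ?enorm_ge0// exprVn.
by apply/implyP => _; rewrite gt_eqF ?enorm_gt0.
Qed.

Lemma symb_psi_rescale r :
  symb l (fun x => nu^-1 * (t - s)^-1 * enorm x `^ gamma)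
    (fun x => psi r (rescale gamma s t x)).
Proof.
apply: le_symb (symb_rescale c_gt0 (symb_psi r)) => x x0.
by rewrite -/(rescale gamma s t x) enorm_rescale mulrA.
Qed.

Lemma cmeasurable_psi_param x : cmeasurable (fun r : measurableTypeR R => psi r x).
Proof.
pose u : Rn R d := [tuple x ord0 i | i < d].
have ux : row_of u = x by apply/rowP => i; rewrite mxE tnth_mktuple.
have mp : measurable_fun setT (fun r : measurableTypeR R => (r, u)).
  exact: measurable_pair2.
have := cmeasurable_comp (symbol_measurable psiP) mp.
by rewrite /comp /= ux.
Qed.

Lemma symb_phase : symb l (fun x => 2 / nu * enorm x `^ gamma) phase.
Proof.
apply: le_symb (@symb_integral _ _ _ (fun r x => psi r (rescale gamma s t x))
  s t (nu^-1 * (t - s)^-1) gamma _ _ symb_psi_rescale _) => [x x0|||x x0].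
- rewrite le_eqVlt; apply/orP; left; apply/eqP; field.
  by rewrite !gt_eqF// subr_gt0.
- exact: ltW.
- by rewrite mulr_ge0 ?invr_ge0 ?ltW.
- exact: cmeasurable_psi_param.
Qed.

Lemma Re_phase_le x : x != 0 -> Re (phase x) <= - nu * enorm x `^ gamma.
Proof.
move=> x0; have mp := (cmeasurable_psi_param (rescale gamma s t x)).1.
rewrite /phase /=.
have -> : - nu * enorm x `^ gamma =
    \int[mu]_(r in `[s, t]) (- nu * enorm (rescale gamma s t x) `^ gamma).
  rewrite [RHS](@Rintegral_cst _ _ _ mu)//.
  rewrite [X in fine X](lebesgue_measure_itv `[s, t])/= lte_fin st -EFinB /=.
  by rewrite enorm_rescale mulrA -mulrA mulrCA mulrA; field; rewrite gt_eqF// subr_gt0.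
apply: le_Rintegral => //.
- apply: (@bounded_integrable _ _ _ (fun r => Re (psi r (rescale gamma s t x)))
    (nu^-1 * enorm (rescale gamma s t x) `^ gamma)) => // r.
  apply: le_trans (normr_Re_le _) _.
  exact: symb_bound (symb_psi r) _ (rescale_neq0 x0).
- pose v : R := - nu * enorm (rescale gamma s t x) `^ gamma.
  by apply: (@bounded_integrable _ _ _ (cst v) `|v|).
- by move=> r _; exact: symbol_elliptic.
Qed.

(* Both [l] and, for the case [a = b = 0], its tail are needed for [l']. *)
Lemma symb_exp_phase (l' : seq 'I_d) :
  (forall (g : 'rV[R]_d -> R) f, symb l g f -> symb l' g f) ->
  symb l' (fun x => (1 + 2 ^+ size l' * (2 / nu * enorm x `^ gamma)) ^+ size l' *
    expR (- nu * enorm x `^ gamma)) (fun x => cexp (phase x)).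
Proof.
move=> ll'; apply: symb_cexp; last exact: Re_phase_le.
by apply: ll'; exact: symb_phase.
Qed.

Lemma cmeasurable_qhat0 a b :
  cmeasurable (fun u : Rn R d => qhat0 gamma psi a b s t (row_of u)).
Proof.
case: (posnP d) => [d0|d_gt0].
  have E (u : Rn R d) : row_of u = 0.
    by apply/rowP => -[i id]; exfalso; move: id; rewrite d0.
  by under eq_fun do rewrite E; exact: cmeasurable_cst.
pose i0 := Ordinal d_gt0.
have rescaleE (u : Rn R d) : rescale gamma s t (row_of u) = row_of (affine c 0 i0 u).
  by rewrite row_of_affine scale0r addr0.
rewrite /qhat0; apply: cmeasurableM; first apply: cmeasurableM.
- apply/cmeasurableX/cmeasurableM; first exact: cmeasurable_cst.
  under eq_fun do rewrite rescaleE.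
  have mp : measurable_fun setT
      (fun u : Rn R d => (t : measurableTypeR R, affine c 0 i0 u)).
    by apply: measurable_fun_pair => //; exact: measurable_affine.
  exact: cmeasurable_comp (symbol_measurable psiP) mp.
- apply: cmeasurable_real; apply: (@measurableT_comp _ _ _ _ _ _ (fun r : R => r `^ b)).
    exact: measurable_powR.
  exact: measurable_row_enorm.
- apply: cmeasurable_cexp.
  have mp : measurable_fun setT (fun p : Rn R d * measurableTypeR R =>
      (p.2, affine c 0 i0 p.1)).
    apply: measurable_fun_pair => //.
    by apply: measurableT_comp => //; exact: measurable_affine.
  have [m1 m2] := cmeasurable_comp (symbol_measurable psiP) mp.
  under eq_fun do rewrite rescaleE.
  split; first exact: (measurable_Rintegral_param _ m1).
  exact: (measurable_Rintegral_param _ m2).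
Qed.

Lemma qhat_bound a b (C : R) :
  (forall l' : seq 'I_d, size l' = mlen alpha ->
    symb l' (fun x => C * enorm x `^ b) (fun x => (enorm x `^ b)%:C)) ->
  let m := mlen alpha in
  mderivable [set x | x != 0] alpha (qhat0 gamma psi a b s t) /\
  forall x, x != 0 -> normc (qhat gamma psi alpha a b s t x) <=
    4 ^+ m * 2 ^+ (m * a) * (2 ^+ m / nu) ^+ a * C *
      weight gamma nu (2 ^+ m * (2 / nu)) (gamma * a%:R + b - m%:R) m (enorm x).
Proof.
move=> HC m.
have sl : size l = m := size_rev_mseq.
have s1 := symbX a (symbM (symb_cst l (t - s)%:C) (symb_psi_rescale t)).
have s2 := symbM (symbM s1 (HC l sl)) (symb_exp_phase (fun _ _ h => h)).
have [dq bq] := symb_foldr s2; split; first exact: dq.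
move=> x x0; apply: le_trans (bq x x0) _.
rewrite size_mseq sl -/m normc_real gtr0_norm// /weight.
have e0 := enorm_gt0 x0; have en0 : enorm x != 0 by rewrite gt_eqF.
have -> : enorm x `^ (gamma * a%:R + b - m%:R) =
    (enorm x `^ gamma) ^+ a * enorm x `^ b * (enorm x)^-1 ^+ m.
  rewrite powRB; last by apply/implyP.
  rewrite powRD; last by apply/implyP.
  by rewrite powRrM !powR_mulrn ?powR_ge0 ?enorm_ge0// exprVn.
have -> : (t - s) * (nu^-1 * (t - s)^-1 * enorm x `^ gamma) = nu^-1 * enorm x `^ gamma.
  by field; rewrite !gt_eqF// subr_gt0.
have -> : 4 ^+ m = 2 ^+ m * 2 ^+ m :> R by rewrite -exprMn -natrM.
rewrite !exprMn [2 ^+ m * (2 / nu * _)]mulrA.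
by rewrite le_eqVlt; apply/orP; left; apply/eqP; ring.
Qed.

Lemma qhat_bound_exp : (0 < mlen alpha)%N ->
  let m := (mlen alpha).-1 in
  mderivable [set x | x != 0] alpha (qhat0 gamma psi 0 0 s t) /\
  forall x, x != 0 -> normc (qhat gamma psi alpha 0 0 s t x) <=
    2 ^+ m * (2 / nu) *
      weight gamma nu (2 ^+ m * (2 / nu)) (gamma - (mlen alpha)%:R) m (enorm x).
Proof.
move=> alpha_gt0 m.
have q0E : qhat0 gamma psi 0 0 s t = (fun x => cexp (phase x)).
  by apply/funext => x; rewrite /qhat0 expr0 powRr0 !mul1r.
rewrite /qhat q0E /mderivable /mderive.
case/lastP E : (mseq alpha) => [|s' i].
  by move: alpha_gt0; rewrite -size_mseq E.
have lE : l = i :: rev s' by rewrite /l E rev_rcons.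
have ss' : size s' = m by rewrite /m -size_mseq E size_rcons.
have ph := symb_phase; have eph := symb_exp_phase (fun _ _ h => h).
have eph' : symb (rev s')
    (fun x => (1 + 2 ^+ size (rev s') * (2 / nu * enorm x `^ gamma)) ^+ size (rev s') *
      expR (- nu * enorm x `^ gamma)) (fun x => cexp (phase x)).
  by apply: symb_exp_phase => g f; rewrite lE => -[].
rewrite lE in ph eph.
have [dq bq] := symb_foldr (symb_cexp_cons ph eph').
have [_ de _] := eph.
split; first by apply/seq_derivable_rcons.
move=> x x0; rewrite foldr_rcons; apply: le_trans (bq x x0) _.
rewrite !size_rev ss' /weight.
have e0 := enorm_gt0 x0; have en0 : enorm x != 0 by rewrite gt_eqF.
have -> : enorm x `^ (gamma - (mlen alpha)%:R) =
    enorm x `^ gamma * ((enorm x)^-1 * (enorm x)^-1 ^+ m).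
  rewrite powRB; last by apply/implyP.
  by rewrite powR_mulrn ?enorm_ge0// -exprS /m prednK// exprVn.
rewrite [2 ^+ m * (2 / nu * _)]mulrA.
by rewrite le_eqVlt; apply/orP; left; apply/eqP; ring.
Qed.

End symbol_estimates.

Lemma qhat_fourier_bound (R : realType) (d : nat) (gamma nu : R) (a : nat) (b : R)
    (m : nat) : (0 < d)%N -> 0 < gamma -> 0 < nu -> (m <= (d %/ 2).+1)%N ->
  exists N : R,
    forall (psi : R -> 'rV[R]_d -> R[i]) (alpha : 'I_d -> nat),
      symbol_assumption gamma nu psi -> mlen alpha = m ->
      (a = 0%N /\ b = 0 /\ (exists i, alpha i <> 0%N)) \/
      (gamma * a%:R + b - m%:R > - d%:R) ->
      forall s t : R, s < t ->
        [/\ mderivable [set xi | xi != 0] alpha (qhat0 gamma psi a b s t),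
            cintegrable (lebesgue_Rn d) setT
              (fun xi => qhat gamma psi alpha a b s t (row_of xi))
          & forall x : 'rV[R]_d, normc (q gamma psi alpha a b s t x) <= N].
Proof.
move=> d0 gamma0 nu0 md.
have ge2 k : 0 <= 2 ^+ k * (2 / nu) by rewrite mulr_ge0// divr_ge0// ltW.
have m_le_d : (m <= d)%N.
  by apply: leq_trans md _; rewrite ltn_Pdiv.
have p1 : - d%:R < gamma - m%:R.
  have : m%:R <= d%:R :> R by rewrite ler_nat.
  by lra.
have [N1 H1] := inv_fourier_bounded m.-1 d0 gamma0 nu0 (ge2 m.-1) (ge2 m.-1) p1.
have [C C0 HC] := @symb_enorm_powR R d m b.
pose K := 4 ^+ m * 2 ^+ (m * a) * (2 ^+ m / nu) ^+ a * C.
have K0 : 0 <= K by rewrite !mulr_ge0// exprn_ge0// mulr_ge0// invr_ge0 ltW.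
have [N2 H2] : exists N2 : R, - d%:R < gamma * a%:R + b - m%:R ->
    forall f : 'rV[R]_d -> R[i],
    cmeasurable (fun t : Rn R d => f (row_of t)) ->
    (forall x, x != 0 -> normc (f x) <=
      K * weight gamma nu (2 ^+ m * (2 / nu)) (gamma * a%:R + b - m%:R) m (enorm x)) ->
    cintegrable (lebesgue_Rn d) setT (fun t => f (row_of t)) /\
    forall x, normc (inv_fourier f x) <= N2.
  have [p2|p2] := ltP (- d%:R) (gamma * a%:R + b - m%:R); last by exists 0.
  by have [N2 H2] := inv_fourier_bounded m d0 gamma0 nu0 (ge2 m) K0 p2; exists N2.
exists (`|N1| + `|N2|) => psi alpha psiP am cases s t st.
have alpha_le : (mlen alpha <= (d %/ 2).+1)%N by rewrite am.
have mq := cmeasurable_qhat0 psiP s t a b.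
case: cases => [[a0 [b0 [i ai]]]|p2].
  move: mq; rewrite a0 b0 => mq.
  have alpha_gt0 : (0 < mlen alpha)%N.
    by rewrite /mlen (bigD1 i)//= addn_gt0 lt0n; apply/orP; left; apply/eqP.
  have [dq bq] := qhat_bound_exp gamma0 nu0 psiP alpha_le st alpha_gt0.
  move: bq; rewrite am => bq.
  have [iq qN] := H1 _ (cmeasurable_mderive mq dq) bq; split => // x.
  by apply: le_trans (qN x) _; rewrite (le_trans (ler_norm _))// lerDl.
have HC' l' : size l' = mlen alpha ->
    symb l' (fun x => C * enorm x `^ b) (fun x : 'rV[R]_d => (enorm x `^ b)%:C).
  by rewrite am; exact: HC.
have [dq bq] := qhat_bound gamma0 nu0 psiP alpha_le st a HC'.
move: bq; rewrite am => bq.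
have [iq qN] := H2 p2 _ (cmeasurable_mderive mq dq) bq; split => // x.
by apply: le_trans (qN x) _; rewrite (le_trans (ler_norm _))// lerDr.
Qed.

Theorem corollary3p3 (R : realType) (d : nat) (gamma nu : R) (a : nat) (b : R)
    (d_gt0 : (0 < d)%N) (gamma_gt0 : 0 < gamma) (nu_gt0 : 0 < nu) :
  exists N : R,
    forall (psi : R -> 'rV[R]_d -> R[i]) (alpha : 'I_d -> nat),
      symbol_assumption gamma nu psi ->
      (mlen alpha <= (d %/ 2).+1)%N ->
      (a = 0%N /\ b = 0 /\ (exists i, alpha i <> 0%N)) \/
      (gamma * a%:R + b - (mlen alpha)%:R > - d%:R) ->
      forall s t : R, s < t ->
        [/\ mderivable [set xi | xi != 0] alpha (qhat0 gamma psi a b s t),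
            cintegrable (lebesgue_Rn d) setT
              (fun xi => qhat gamma psi alpha a b s t (row_of xi))
          & forall x : 'rV[R]_d, normc (q gamma psi alpha a b s t x) <= N].
Proof.
have /choice[N HN] : forall m : 'I_(d %/ 2).+2, exists N : R,
    forall (psi : R -> 'rV[R]_d -> R[i]) (alpha : 'I_d -> nat),
      symbol_assumption gamma nu psi -> mlen alpha = m ->
      (a = 0%N /\ b = 0 /\ (exists i, alpha i <> 0%N)) \/
      (gamma * a%:R + b - m%:R > - d%:R) ->
      forall s t : R, s < t ->
        [/\ mderivable [set xi | xi != 0] alpha (qhat0 gamma psi a b s t),
            cintegrable (lebesgue_Rn d) setT
              (fun xi => qhat gamma psi alpha a b s t (row_of xi))
          & forall x : 'rV[R]_d, normc (q gamma psi alpha a b s t x) <= N].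
  by move=> m; apply: qhat_fourier_bound => //; rewrite -ltnS.
exists (\sum_m `|N m|) => psi alpha psiP alpha_le cases s t st.
have m_lt : (mlen alpha < (d %/ 2).+2)%N by rewrite ltnS.
have [dq iq qN] := HN (Ordinal m_lt) psi alpha psiP erefl cases s t st.
split => // x; apply: le_trans (qN x) _; apply: le_trans (ler_norm _) _.
by rewrite (bigD1 (Ordinal m_lt))//= lerDl sumr_ge0.
Qed.
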